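(* Let $b\in S=[L^1(0,1)]^q$, let $(\hat b_n)_{n\in\mathbb{N}}$ be a sequence of estimators of $b$, and let $\tilde b_n=\hat b_n-b$, where $(\tilde b_n)_{n\in\mathbb{N}}\subset S$. Suppose that $\sqrt n\,\tilde b_n=\sqrt n(\hat b_n-b)$ converges weakly in $S$, as $n\to\infty$, to a $q$-dimensional Gaussian process $\{G(p)\}_{p\in(0,1)}$ with mean $m(p)=0$ for each $p\in(0,1)$ and matrix-valued covariance function $R(p,s)$, such that $G\in S$. Let $0=\lambda_0<\lambda_1<\dots<\lambda_K=1$, and for $k=1,\dots,K$ let $B_k=\int_{\lambda_{k-1}}^{\lambda_k} b(p)\,\mathrm{d}p$ and $\hat B_{k,n}=\int_{\lambda_{k-1}}^{\lambda_k}\hat b_n(p)\,\mathrm{d}p$ (integrals taken coordinate-wise). Then, for $k=1,\dots,K$, $\sqrt n(\hat B_{k,n}-B_k)$ is asymptotically multivariate normal with mean $0$ and covariance matrix $$\Sigma_k=\int_{\lambda_{k-1}}^{\lambda_k}\int_{\lambda_{k-1}}^{\lambda_k}R(p,s)\,\mathrm{d}p\,\mathrm{d}s,$$ i.e. it converges weakly in $\mathbb{R}^q$ to the multivariate normal distribution with mean $0$ and covariance matrix $\Sigma_k$.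
   Context: $S=[L^1(0,1)]^q$ is the $q$-dimensional product of $L^1(0,1)$ with norm $\lVert b\rVert_S=\sum_{i=1}^q\lVert b^i\rVert_{L^1}$. The covariance function of the centered $\mathbb{R}^q$-valued process $G$ is the $q\times q$ matrix-valued function $R(p,s)=\mathrm{E}\{G(p)G(s)^T\}$; $G\in S$ means that the paths of $G$ belong to $S$. The setting: $Y_1,\dots,Y_n$ are independent replicates of a real random variable $Y$ with $\mathrm{E}(Y)<\infty$, with fixed given covariate vectors $x_1,\dots,x_n\in\mathbb{R}^m$; the conditional quantile function of $Y$ given $x$ is modeled as $Q(p|x)=t(x)^Tb(p)$, with $t:\mathbb{R}^m\to\mathbb{R}^q$ a transformation of $x$ and $b:(0,1)\to\mathbb{R}^q$ coordinate-wise integrable. An estimator $\hat b_n$ is a random element of $S$ computed from the sample $\{(Y_j,x_j)\}_{j=1}^n$.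
   Formalization: The Gaussian process G is additionally assumed jointly measurable in the sample point and p; without this, a pathological version with paths zero almost everywhere but covariance R=1 makes the claim false. *)

(* Defs.v *)
From HB Require Import structures.
From mathcomp Require Import all_boot all_order all_algebra.
From mathcomp Require Import all_classical all_reals all_analysis.

Set Implicit Arguments.
Unset Strict Implicit.
Unset Printing Implicit Defensive.

Import Order.TTheory GRing.Theory Num.Theory.
Import numFieldNormedType.Exports.

Local Open Scope classical_set_scope.
Local Open Scope ring_scope.

(* Lebesgue measure on (0,1), as a measure on [R] carried by (0,1). *)
Definition leb01 (R : realType) :=
  mrestr (@lebesgue_measure R) (measurable_itv `]0%R, 1%R[).
HB.instance Definition _ (R : realType) := Measure.on (@leb01 R).

(* An element is a q-tuple of integrable functions rather than of their a.e.
   classes: the topology below comes from a seminorm, two elements being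
   topologically indistinguishable iff they are a.e. equal on (0,1). Open sets,
   Borel sets and continuous functionals are therefore exactly those of the
   Banach space of classes, while the values [b p] remain meaningful, which a
   stochastic process with paths in the space requires. *)
Definition L1q (R : realType) (q : nat) : Type :=
  {ffun 'I_q -> LfunType (@leb01 R) (lexx (1%E : \bar R))}.

HB.instance Definition _ (R : realType) (q : nat) :=
  GRing.Lmodule.on (L1q R q).
HB.instance Definition _ (R : realType) (q : nat) :=
  isPointed.Build (L1q R q) 0.

(* Only the values at [p] in (0,1) are relevant. *)
Definition L1q_fun (R : realType) (q : nat) (b : L1q R q) (p : R) : 'cV[R]_q :=
  \col_i (b : {ffun _}) i p.
Coercion L1q_fun : L1q >-> Funclass.

Definition L1q_norm (R : realType) (q : nat) (b : L1q R q) : R :=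
  \sum_(i < q) fine 'N[@leb01 R]_1[EFin \o ((b : {ffun _}) i)]%E.

Section L1q_topology.
Variables (R : realType) (q : nat).

Let L1q_ball (x : L1q R q) (e : R) : set (L1q R q) :=
  [set y | L1q_norm (x - y) < e].

Let ent : set_system (L1q R q * L1q R q) := entourage_ L1q_ball.

Let nbhs_L1q (x : L1q R q) : set_system (L1q R q) := nbhs_ ent x.

HB.instance Definition _ := hasNbhs.Build (L1q R q) nbhs_L1q.

Lemma L1q_norm0 : L1q_norm (0 : L1q R q) = 0.
Proof.
rewrite /L1q_norm big1// => i _; rewrite ffunE.
rewrite (_ : EFin \o _ = cst 0%E)//.
by rewrite Lnorm0// oner_eq0.
Qed.

Lemma L1q_normN (x : L1q R q) : L1q_norm (- x) = L1q_norm x.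
Proof.
rewrite /L1q_norm; apply: eq_bigr => i _.
have -> : (- x : {ffun _}) i = - ((x : {ffun _}) i) by rewrite ffunE.
exact: (@LnormrN _ _ _ _ _ _ ((x : {ffun _}) i)).
Qed.

Lemma ler_L1q_normD (x y : L1q R q) :
  L1q_norm (x + y) <= L1q_norm x + L1q_norm y.
Proof.
rewrite /L1q_norm -big_split; apply: ler_sum => i _.
have -> : (x + y : {ffun _}) i = (x : {ffun _}) i + (y : {ffun _}) i.
  by rewrite ffunE.
exact: ler_LnormD.
Qed.

Let L1q_ball_center x (e : R) : 0 < e -> L1q_ball x e x.
Proof. by move=> e0; rewrite /L1q_ball/= subrr L1q_norm0. Qed.

Let L1q_ball_sym x y (e : R) : L1q_ball x e y -> L1q_ball y e x.
Proof. by rewrite /L1q_ball/= -[x - y]opprB L1q_normN. Qed.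

Let L1q_ball_triangle x y z (e1 e2 : R) :
  L1q_ball x e1 y -> L1q_ball y e2 z -> L1q_ball x (e1 + e2) z.
Proof.
rewrite /L1q_ball/= => xy yz.
rewrite -(subrK y x) -addrA.
by rewrite (le_lt_trans (ler_L1q_normD _ _))// ltrD.
Qed.

Let nbhs_L1qE : @nbhs _ (L1q R q) = nbhs_ ent. Proof. by []. Qed.
Let entE : ent = entourage_ L1q_ball. Proof. by []. Qed.

HB.instance Definition _ := Nbhs_isPseudoMetric.Build R (L1q R q)
  nbhs_L1qE L1q_ball_center L1q_ball_sym L1q_ball_triangle entE.

Lemma ball_L1qE (x : L1q R q) (e : R) :
  ball x e = [set y | L1q_norm (x - y) < e].
Proof. by []. Qed.

End L1q_topology.

Definition borel (T : ptopologicalType) := g_sigma_algebraType (@open T).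

Definition weak_cvg (T : ptopologicalType) (R : realType) (d : measure_display)
    (Omega : measurableType d) (P : probability Omega R) (X : nat -> Omega -> T)
    (nu : probability (borel T) R) : Prop :=
  (forall n, measurable_fun [set: Omega] (X n : Omega -> borel T)) /\
  forall f : T -> R, continuous f -> (exists M, forall x, `|f x| <= M) ->
    ('E_P[fun w => f (X n w)] @[n --> \oo] --> 'E_nu[f])%E.

(* [normal_prob c 0] is not a point mass in the library, so the degenerate case
   is separated. *)
Definition normal_law (R : realType) (c s : R) : set R -> \bar R :=
  if s == 0 then \d_c else normal_prob c s.

Definition is_normal (d : measure_display) (Omega : measurableType d)
    (R : realType) (P : probability Omega R) (X : Omega -> R) : Prop :=
  measurable_fun [set: Omega] X /\
  exists c s : R, forall A : set R, measurable A ->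
    P (X @^-1` A) = normal_law c s A.

Definition jointly_normal (d : measure_display) (Omega : measurableType d)
    (R : realType) (P : probability Omega R) (I : finType)
    (X : I -> Omega -> R) : Prop :=
  forall a : I -> R, is_normal P (fun w => \sum_i a i * X i w).

(* [nu] is the law N(m, Sigma) on R^q; [Sigma] may be singular. *)
Definition multivariate_normal (R : realType) (q : nat)
    (nu : probability (borel 'cV[R]_q) R) (m : 'cV[R]_q) (Sigma : 'M[R]_q) :
    Prop :=
  [/\ jointly_normal nu (fun (i : 'I_q) (z : 'cV[R]_q) => z i 0),
      forall i, ('E_nu[fun z : 'cV[R]_q => (z i 0)%R] = (m i 0)%:E)%E &
      forall i j, covariance nu (fun z : 'cV[R]_q => z i 0)
                               (fun z : 'cV[R]_q => z j 0) = (Sigma i j)%:E].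

(* The process [p |-> G p] on (0,1), all of whose paths [p |-> G w p] are in
   [L1q R q], is Gaussian with mean 0 and covariance function [Rcov].  As usual
   for processes with paths in L^1, it is a measurable process, i.e. jointly
   measurable in [(w, p)]: without this the random element [G] of L1q, which
   only sees a.e. classes of paths, would not be determined in law by the
   finite-dimensional distributions. *)
Definition centered_gaussian_process (R : realType) (q : nat)
    (d : measure_display) (Omega : measurableType d) (P : probability Omega R)
    (G : Omega -> L1q R q) (Rcov : R -> R -> 'M[R]_q) : Prop :=
  [/\ forall i : 'I_q, measurable_fun
        ([set: Omega] `*` (`]0, 1[%classic : set (measurableTypeR R)))
        (fun wp => G wp.1 wp.2 i 0),
      forall (N : nat) (p : 'I_N -> R), (forall k, p k \in `]0, 1[) ->
        jointly_normal P (fun (ki : 'I_N * 'I_q) w => G w (p ki.1) ki.2 0),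
      forall p, p \in `]0, 1[ -> forall i, ('E_P[fun w => (G w p i 0)%R] = 0)%E &
      forall p s, p \in `]0, 1[ -> s \in `]0, 1[ -> forall i j,
        ('E_P[fun w => (G w p i 0 * G w s j 0)%R] = (Rcov p s i j)%:E)%E].

Definition mutually_independent (d : measure_display) (Omega : measurableType d)
    (R : realType) (P : probability Omega R) (Y : nat -> Omega -> R) : Prop :=
  forall (n : nat) (A : nat -> set R), (forall j, measurable (A j)) ->
    P (\bigcap_(j in `I_n) (Y j @^-1` A j)) =
    (\prod_(j < n) P (Y j @^-1` A j))%E.

Definition quantile (d : measure_display) (Omega : measurableType d)
    (R : realType) (P : probability Omega R) (Y : {RV P >-> R}) (p : R) : R :=
  inf [set y | (p%:E <= cdf Y y)%E].

(* [Y j] is drawn from the conditional law given the covariate vector [x j],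
   whose quantile function is [p |-> t (x j)^T b(p)]; [b] being an element of
   L^1, the identity is required for a.e. p. *)
Definition linear_quantile_sample (R : realType) (m q : nat)
    (d : measure_display) (Omega : measurableType d) (P : probability Omega R)
    (Y : nat -> {RV P >-> R}) (x : nat -> 'cV[R]_m)
    (t : 'cV[R]_m -> 'cV[R]_q) (b : L1q R q) : Prop :=
  [/\ mutually_independent P Y,
      forall j, P.-integrable [set: Omega] (EFin \o Y j) &
      forall j, {ae @leb01 R, forall p,
        quantile (Y j) p = ((t (x j))^T *m b p) 0 0}].

(* [bhat] is a function, up to a.e. equality, of {(Y_j, x_j) : j < n}. *)
Definition computed_from_sample (R : realType) (m q : nat) (Omega : Type)
    (Y : nat -> Omega -> R) (x : nat -> 'cV[R]_m) (n : nat)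
    (bhat : Omega -> L1q R q) : Prop :=
  exists T : ('I_n -> R * 'cV[R]_m) -> L1q R q,
    forall w, L1q_norm (bhat w - T (fun j => (Y j w, x j))) = 0.

Definition itv_integral (R : realType) (q : nat) (b : R -> 'cV[R]_q)
    (l u : R) : 'cV[R]_q :=
  \col_i \int[@lebesgue_measure R]_(p in `]l, u[) b p i 0.

Definition itv_integral2 (R : realType) (q : nat) (C : R -> R -> 'M[R]_q)
    (l u : R) : 'M[R]_q :=
  \matrix_(i, j) \int[@lebesgue_measure R]_(s in `]l, u[)
    (\int[@lebesgue_measure R]_(p in `]l, u[) C p s i j).

(* Main.v *)
(* A centered Gaussian process H(w, p) with integrable paths satisfies
   \int sd(H p) dp < oo: on an event of probability 3/4 the L^1 norm of the path
   is bounded, and by the scaling of the normal law the truncated expectation of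
   |H p| is still at least a fixed multiple of sd(H p).  Hence I = \int H(p) dp is
   in L^2 and E(xi I) = \int E(xi H p) dp for xi in L^2, which yields the
   covariances.  Replacing xi by the accumulated error, some point p does not
   increase the error beyond a bounded variance (Maurey's greedy argument), so
   I is an L^2-limit of averages of multiples of the H p, hence of centered
   normal variables, hence centered normal.  Integration over a subinterval is
   Lipschitz on L^1, and the theorem follows by continuous mapping. *)
Require Import Defs.
From HB Require Import structures.
From mathcomp Require Import all_boot all_order all_algebra.
From mathcomp Require Import all_classical all_reals all_analysis measurable_realfun.
From mathcomp Require Import ring lra.

Set Implicit Arguments.
Unset Strict Implicit.
Unset Printing Implicit Defensive.

Import Order.TTheory GRing.Theory Num.Theory.
Import numFieldNormedType.Exports.

Local Open Scope classical_set_scope.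
Local Open Scope ring_scope.

(** * Normal laws *)

(** The hypotheses speak of finitely many points p at a time, while the integral of a path sees no
    single point; joint measurability, through Fubini and Tonelli, links the two. Paths are merely
    integrable, so Riemann sums along prescribed points need not converge to the integral, and each
    point is chosen in view of the error already made. Its own error has a nonpositive inner product
    with the accumulated one, so N errors of norm at most 2S add up to a squared norm of at most
    N(2S)^2, and their average has norm at most 2S / sqrt N. The finiteness of the iterated integral
    of the covariance function likewise rests on the integrability of the standard deviations, since
    |R_ij(p, s)| <= sd_i(p) sd_j(s). Joint normality is a statement on linear combinations, so
    normality is proved for the scalar processes obtained from G with fixed coefficients. *)

Section normal_law_affine.
Context {R : realType}.
Notation leb := (@lebesgue_measure R).

Let affine (a b : R) (z : measurableTypeR R) : measurableTypeR R := a * z + b.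

Let measurable_affine (a b : R) : measurable_fun [set: measurableTypeR R] (affine a b).
Proof. by apply: measurable_funD => //; exact: measurable_funM. Qed.

(** The image of Lebesgue measure under z -> az + b, multiplied by a, gives every interval []u, v]]
    its length, and Lebesgue measure is determined by these values. *)
Lemma ge0_integral_affine (a b : R) (f : R -> \bar R) : 0 < a ->
  measurable_fun [set: measurableTypeR R] f -> (forall x, 0 <= f x)%E ->
  (\int[leb]_x f x = a%:E * \int[leb]_z f (a * z + b)%R)%E.
Proof.
move=> a0 mf f0; pose k : {nonneg R} := NngNum (ltW a0).
have mA := measurable_affine a b.
pose m := mscale k (measure_function_pushforward__canonical__measure_function_Measure leb mA).
transitivity (\int[m]_x f x)%E; last first.
  rewrite ge0_integral_mscale//; congr (_ * _)%E.
  by rewrite ge0_integral_pushforward//; apply: in2W.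
apply: eq_measure_integral => A mA' _.
apply: (@lebesgue_measure_unique R m) => // _ [[u v]] _ <-/=.
rewrite /mscale/= /pushforward.
rewrite (_ : affine a b @^-1` _ = `](u - b) / a, (v - b) / a]%classic); last first.
  apply/seteqP; split => z /=; rewrite !in_itv/= /affine => /andP[uz zv].
    by rewrite ltr_pdivrMr// ler_pdivlMr// mulrC; apply/andP; split; lra.
  by move: uz zv; rewrite ltr_pdivrMr// ler_pdivlMr// mulrC => uz zv;
    apply/andP; split; lra.
rewrite !lebesgue_measure_itv/= !lte_fin ltr_pM2r ?invr_gt0// ltrBlDr subrK.
case: ifPn => _; last by rewrite mule0.
by rewrite -!EFinB -EFinM; congr EFin; field; rewrite gt_eqF.
Qed.

(** The Jacobian s of the substitution cancels the factor 1/s contained in [normal_peak]. *)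
Lemma normal_prob_affine (c s : R) (A : set R) : 0 < s -> measurable A ->
  normal_prob c s A = normal_prob 0 1 ((fun z => s * z + c) @^-1` A).
Proof.
move=> s0 mA; rewrite /normal_prob integral_mkcond.
have mA' : measurable ((fun z => s * z + c) @^-1` A).
  by rewrite -[X in measurable X]setTI; exact: measurable_affine.
rewrite (ge0_integral_affine c s0); last 2 first.
- apply/(measurable_restrictT _ mA)/measurable_EFinP/measurable_funTS.
  exact: measurable_normal_pdf.
- by apply: erestrict_ge0 => x _; rewrite lee_fin normal_pdf_ge0.
rewrite [RHS]integral_mkcond -ge0_integralZl//; last 3 first.
- apply: (@measurableT_comp _ _ _ _ _ _ _ _ (affine s c)) => //.
  apply/(measurable_restrictT _ mA)/measurable_EFinP/measurable_funTS.
  exact: measurable_normal_pdf.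
- by move=> x _; apply: erestrict_ge0 => y _; rewrite lee_fin normal_pdf_ge0.
- by rewrite lee_fin ltW.
apply: eq_integral => z _; rewrite !patchE.
have -> : (z \in (fun z => s * z + c) @^-1` A) = (s * z + c \in A) by [].
case: ifPn => _; last by rewrite mule0.
rewrite -EFinM; congr EFin.
rewrite !normal_pdfE ?oner_eq0 ?gt_eqF// mulrA; congr (_ * _).
  rewrite /normal_peak expr1n mul1r -mulrnAr sqrtrM ?sqr_ge0//.
  by rewrite sqrtr_sqr gtr0_norm// invfM mulrA divff ?gt_eqF// mul1r.
rewrite /normal_fun subr0 addrK expr1n; congr expR.
by field; rewrite gt_eqF.
Qed.

Lemma normal_prob_atomless (c s r : R) : s != 0 -> normal_prob c s [set r] = 0%E.
Proof.
move=> s0; rewrite /normal_prob integral_set1//.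
Qed.

End normal_law_affine.

(** * Equality of laws and affine images of N(0,1) *)

Section law.
Context {d} {T : measurableType d} {R : realType} (P : probability T R).

Definition same_law d' (T' : measurableType d') (P' : probability T' R)
    (X : T -> R) (Y : T' -> R) :=
  forall A : set R, measurable A -> P (X @^-1` A) = P' (Y @^-1` A).

(** Positive and negative parts are transported separately, so the identity also covers infinite
    integrals. *)
Lemma same_law_integral d' (T' : measurableType d') (P' : probability T' R)
    (X : T -> R) (Y : T' -> R) (f : R -> \bar R) :
  measurable_fun setT X -> measurable_fun setT Y ->
  measurable_fun setT f -> same_law P' X Y ->
  (\int[P]_w f (X w) = \int[P']_w f (Y w))%E.
Proof.
move=> mX mY mf XY.
have ge0 g : measurable_fun setT g -> (forall x, 0 <= g x)%E ->
    (\int[P]_w g (X w) = \int[P']_w g (Y w))%E.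
  move=> mg g0; transitivity (\int[pushforward P X]_x g x)%E.
    by rewrite ge0_integral_pushforward//; exact: in2W.
  transitivity (\int[pushforward P' Y]_x g x)%E.
    by apply: eq_measure_integral => A mA _; exact: XY.
  by rewrite ge0_integral_pushforward//; exact: in2W.
rewrite [LHS]integralE [RHS]integralE.
rewrite -/(f \o X) -/(f \o Y).
rewrite (funepos_comp f X) (funepos_comp f Y) (funeneg_comp f X) (funeneg_comp f Y).
congr (_ - _)%E.
- exact: (ge0 _ (measurable_funepos mf) (funepos_ge0 f)).
- exact: (ge0 _ (measurable_funeneg mf) (funeneg_ge0 f)).
Qed.

(** The scale of an affine image of N(0,1) can be taken nonnegative, and the value 0 gives the point
    masses, so later proofs treat all normal laws in one form. *)
Lemma is_normal_affine (X : T -> R) : is_normal P X ->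
  exists c s : R, 0 <= s /\
    same_law (normal_prob 0 1) X (fun z => s * z + c).
Proof.
move=> [mX [c [s Xcs]]].
have [s0|s0|s0] := ltrgt0P s.
- exists c, s; split; first exact: ltW.
  move=> A mA; rewrite (Xcs _ mA) /normal_law (gt_eqF s0); exact: normal_prob_affine.
(* The parameter of [is_normal] may be negative; the density depends on its square only. *)
- exists c, (- s); split; first by rewrite oppr_ge0 ltW.
  move=> A mA; rewrite (Xcs _ mA) /normal_law (lt_eqF s0).
  transitivity (normal_prob c (- s) A); last first.
    by apply: normal_prob_affine => //; rewrite oppr_gt0.
  apply: eq_integral => x _.
  by rewrite /normal_pdf oppr_eq0 /normal_peak /normal_fun sqrrN.
- exists c, 0; split => // A mA; rewrite (Xcs _ mA) /normal_law s0 eqxx.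
  have -> : (fun z => 0 * z + c) = cst c by apply/funext => z; rewrite mul0r add0r.
  rewrite preimage_cst diracE; case: ifPn => _; last by rewrite measure0.
  by rewrite probability_setT.
Qed.

Lemma affine_is_normal (X : T -> R) (c s : R) : measurable_fun setT X -> 0 <= s ->
  same_law (normal_prob 0 1) X (fun z => s * z + c) -> is_normal P X.
Proof.
move=> mX; rewrite le_eqVlt => /predU1P[<-|s0] XZ; split => //.
- exists c, 0 => A mA; rewrite (XZ _ mA) /normal_law eqxx.
  have -> : (fun z => 0 * z + c) = cst c by apply/funext => z; rewrite mul0r add0r.
  rewrite preimage_cst diracE; case: ifPn => _; last by rewrite measure0.
  by rewrite probability_setT.
- exists c, s => A mA; rewrite (XZ _ mA) /normal_law (gt_eqF s0).
  by apply/esym/normal_prob_affine.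
Qed.

Lemma is_normalZ (X : T -> R) (a : R) : 0 <= a -> is_normal P X ->
  is_normal P (fun w => a * X w).
Proof.
move=> a0 nX; have [mX _] := nX; have [c [s [s0 XZ]]] := is_normal_affine nX.
apply: (@affine_is_normal _ (a * c) (a * s)); first exact: measurable_funM.
  exact: mulr_ge0.
move=> A mA; have mA' : measurable ( *%R a @^-1` A).
  by rewrite -[X in measurable X]setTI; apply: measurable_funM.
transitivity (P (X @^-1` ( *%R a @^-1` A))); first by [].
rewrite (XZ _ mA'); congr (normal_prob 0 1 _).
by apply/seteqP; split => z /=; rewrite mulrDr mulrA.
Qed.

End law.

(** The point mass at 0 is included. Square integrability is part of the notion because the law is
    identified by the second moment. *)
Definition centered_normal d (T : measurableType d) (R : realType)
    (P : probability T R) (X : T -> R) :=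
  [/\ X \in Lfun P 2%:E, ('E_P[X] = 0)%E & is_normal P X].

(** Extended-valued, so that its finiteness can serve to prove membership in L^2. *)
Definition moment2 d (T : measurableType d) (R : realType)
    (P : probability T R) (X : T -> R) : \bar R := ('E_P[fun w => (X w ^+ 2)%R])%E.

Section centered_normal.
Context {R : realType}.
Let N01 : probability _ R := @normal_prob R 0 1.

Let N01_atomless (r : R) : N01 [set r] = 0%E.
Proof. by apply: normal_prob_atomless; exact: oner_neq0. Qed.

Section one_variable.
Context {d} {T : measurableType d} (P : probability T R) (X : T -> R).
Hypothesis X0 : centered_normal P X.
Variables (c s : R).
Hypothesis XZ : same_law P N01 X (fun z => s * z + c).

Let mX : measurable_fun setT X. Proof. by case: X0 => _ _ []. Qed.

Let maff : measurable_fun setT (fun z : measurableTypeR R => s * z + c).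
Proof. by apply: measurable_funD => //; exact: measurable_funM. Qed.

Let X2E : (moment2 P X = \int[N01]_z ((s * z + c) ^+ 2)%:E)%E.
Proof.
rewrite /moment2 unlock.
apply: (same_law_integral (f := fun x : R => (x ^+ 2)%:E) mX maff _ XZ).
by apply/measurable_EFinP; exact: measurable_funX.
Qed.

Lemma degenerate_centered_normal : s = 0 -> c = 0 /\ moment2 P X = 0%E.
Proof.
move=> s0; have c0 : c = 0.
  have [_ + _] := X0; rewrite unlock.
  rewrite (same_law_integral (f := @EFin R) mX maff _ XZ)//.
  rewrite s0; under eq_integral do rewrite mul0r add0r.
  by rewrite integral_cst//= probability_setT mule1 => -[].
split => //; rewrite X2E s0 c0.
by under eq_integral do rewrite mul0r add0r expr0n/=; rewrite integral0.
Qed.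

(** If 0 < s, then sz + c = 0 for almost every z, and N(0,1) would be carried by the single point
    -c/s, which has probability 0. *)
Lemma centered_normal_degenerate : 0 <= s -> moment2 P X = 0%E -> s = 0.
Proof.
rewrite le_eqVlt => /predU1P[->//|s0]; rewrite X2E => i0.
have : ae_eq N01 setT (fun z => ((s * z + c) ^+ 2)%:E) (cst 0%E).
  apply/ae_eq_integral_abs => //.
    by apply/measurable_EFinP; exact: measurable_funX.
  rewrite -i0; apply: eq_integral => z _.
  by rewrite gee0_abs// lee_fin sqr_ge0.
move=> [A [mA A0 subA]].
have subA' : ~` [set (- c / s)] `<=` A.
  move=> z /= zc; apply: subA => /= /(_ I) [] /eqP; rewrite sqrf_eq0 => /eqP h.
  apply: zc; apply: (mulIf (x := s)); first by rewrite gt_eqF.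
  by rewrite divfK ?gt_eqF//; lra.
have : (N01 setT <= 0)%E.
  pose B : set R := [set - c / s].
  have Nc : (N01 (~` B) <= 0)%E.
    rewrite -A0 le_measure ?inE//.
    by apply: measurableC; exact: measurable_set1.
  have Nc' : (N01 B <= 0)%E by have /eqP := N01_atomless (- c / s); rewrite eq_le => /andP[].
  have := leeD Nc Nc'; rewrite adde0; apply: le_trans.
  rewrite -{1}(setvU B); apply: measureU2; last exact: measurable_set1.
  by apply: measurableC; exact: measurable_set1.
by rewrite probability_setT leNgt lte01.
Qed.

End one_variable.

(* The two laws are affine images of one another, so that the moments of N(0,1)
   are not needed. *)
Lemma centered_normal_unique d d' (T : measurableType d) (T' : measurableType d')
    (P : probability T R) (P' : probability T' R) (X : T -> R) (Y : T' -> R) :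
  centered_normal P X -> centered_normal P' Y ->
  moment2 P X = moment2 P' Y -> same_law P P' X Y.
Proof.
move=> X0 Y0 XY2.
have [X2 EX nX] := X0; have [Y2 EY nY] := Y0.
have [[mX _] [mY _]] := (nX, nY).
have [c [s [s0 XZ]]] := is_normal_affine nX.
have [c' [s' [s'0 YZ]]] := is_normal_affine nY.
suff [ss' cc'] : s = s' /\ c = c'.
  by move=> A mA; rewrite (XZ _ mA) (YZ _ mA) ss' cc'.
have [s00|sneq0] := eqVneq s 0.
  have [c0 EX2] := degenerate_centered_normal X0 XZ s00.
  have s'00 : s' = 0 by apply: (centered_normal_degenerate Y0 YZ) => //; rewrite -XY2.
  by have [-> _] := degenerate_centered_normal Y0 YZ s'00; rewrite s00 s'00.
have [s'00|s'neq0] := eqVneq s' 0.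
  have [c0 EY2] := degenerate_centered_normal Y0 YZ s'00.
  have s00 : s = 0 by apply: (centered_normal_degenerate X0 XZ) => //; rewrite XY2.
  by rewrite s00 eqxx in sneq0.
have {}s0 : 0 < s by rewrite lt_neqAle eq_sym sneq0.
have {}s'0 : 0 < s' by rewrite lt_neqAle eq_sym s'neq0.
(* Eliminating z between sz + c and s'z + c' shows that [Y] has the law of aX + b. Comparing
   expectations gives b = 0, and comparing second moments gives a^2 = 1 with a > 0. *)
pose a := s' / s; pose b := c' - a * c.
have mh : measurable_fun setT (fun x : measurableTypeR R => a * x + b).
  by apply: measurable_funD => //; exact: measurable_funM.
have YX : same_law P' P Y (fun w => a * X w + b).
  move=> A mA; have mA' : measurable ((fun x : measurableTypeR R => a * x + b) @^-1` A).
    by rewrite -[X in measurable X]setTI; exact: mh.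
  rewrite (YZ _ mA); transitivity (P (X @^-1` ((fun x => a * x + b) @^-1` A))); last by [].
  rewrite (XZ _ mA'); congr (normal_prob 0 1 _).
  apply/seteqP; split => z /=; suff -> : a * (s * z + c) + b = s' * z + c' by [].
    by rewrite /b /a; field; rewrite gt_eqF.
  by rewrite /b /a; field; rewrite gt_eqF.
have Pfin : P setT \is a fin_num by rewrite probability_setT.
have X1 : X \in Lfun P 1 by apply: Lfun_subset12.
have mY' : measurable_fun setT (fun w => a * X w + b).
  by apply: measurable_funD => //; exact: measurable_funM.
have b0 : b = 0.
  move: EY; rewrite unlock (same_law_integral (f := @EFin R) mY mY' _ YX)//.
  have -> : (\int[P]_w (a * X w + b)%:E =
      'E_P[((fun w => a * X w) \+ cst b)%R])%E by rewrite unlock.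
  rewrite expectationD; last 2 first.
  - have -> : (fun w => a * X w) = a \o* X by apply/funext => w /=; rewrite mulrC.
    exact: Lfun_scale.
  - exact: Lfun_cst.
  rewrite expectation_cst.
  have -> : (fun w => a * X w) = a \o* X by apply/funext => w /=; rewrite mulrC.
  by rewrite expectationZl// EX mule0 add0e => -[].
have a1 : a ^+ 2 = 1.
  have : ((a ^+ 2)%R%:E * moment2 P X = moment2 P X)%E.
    rewrite [RHS]XY2 /moment2 [in RHS]unlock.
    rewrite (same_law_integral (f := fun x : R => (x ^+ 2)%:E) mY mY' _ YX); last first.
      by apply/measurable_EFinP; exact: measurable_funX.
    rewrite unlock -ge0_integralZl//; last 3 first.
    - by apply/measurable_EFinP; exact: measurable_funX.
    - by move=> w _; rewrite lee_fin sqr_ge0.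
    - by rewrite lee_fin sqr_ge0.
    by apply: eq_integral => w _; rewrite b0 addr0 (exprMn _ _ (X w)) EFinM.
  have : moment2 P X \is a fin_num.
    by apply/expectation_fin_num/Lfun1_integrable/Lfun2_integrable_sqr.
  case E : (moment2 P X) => [r||]// _ [] rE.
  apply: (mulIf (x := r)); last by rewrite mul1r.
  apply/negP => /eqP r0; move/negP: sneq0; apply; apply/eqP.
  by apply: (centered_normal_degenerate X0 XZ) => //; [exact: ltW|rewrite E r0].
have {}a1 : a = 1.
  have : (a - 1) * (a + 1) = 0 by lra.
  move/eqP; rewrite mulf_eq0 => /orP[|] /eqP; first by lra.
  by have : 0 < a by [exact: divr_gt0]; lra.
split; last by move: b0; rewrite /b a1; lra.
have <- : a * s = s' by rewrite /a divfK ?gt_eqF.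
by rewrite a1 mul1r.
Qed.

Lemma centered_normal_atomless d (T : measurableType d) (P : probability T R)
    (X : T -> R) (r : R) :
  centered_normal P X -> moment2 P X != 0%E -> P (X @^-1` [set r]) = 0%E.
Proof.
move=> X0; have [_ _ nX] := X0; have [c [s [s0 XZ]]] := is_normal_affine nX.
move=> X2; rewrite (XZ _ (measurable_set1 r)).
have sneq0 : s != 0.
  apply: contra X2 => /eqP s00.
  by have [_ ->] := degenerate_centered_normal X0 XZ s00.
transitivity (N01 [set (r - c) / s]); last exact: N01_atomless.
congr (normal_prob 0 1 _); apply/seteqP; split => z /=.
  by move=> <-; field.
by move=> ->; field.
Qed.

Lemma centered_normalZ d (T : measurableType d) (P : probability T R)
    (X : T -> R) (a : R) : 0 <= a -> centered_normal P X ->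
  centered_normal P (fun w => a * X w).
Proof.
move=> a0 [X2 EX nX].
have aX : (fun w => a * X w) = a \o* X by apply/funext => w /=; rewrite mulrC.
split; last exact: is_normalZ.
- by rewrite aX; apply: Lfun_scale => //; rewrite ler1n.
- have Pfin : P setT \is a fin_num by rewrite probability_setT.
  by rewrite aX (expectationZl a (Lfun_subset12 Pfin X2)) EX mule0.
Qed.

End centered_normal.

(** * Laws of mean-square limits *)

Section law_limit.
Context {R : realType}.

Lemma same_law_cdf d d' (T : measurableType d) (T' : measurableType d')
    (P : probability T R) (P' : probability T' R) (X : T -> R) (Y : T' -> R) :
  measurable_fun setT X -> measurable_fun setT Y ->
  (forall x, P (X @^-1` `]-oo, x]) = P' (Y @^-1` `]-oo, x])) -> same_law P P' X Y.
Proof.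
move=> mX mY XY A mA.
pose X' : {RV P >-> R} := HB.pack X (isMeasurableFun.Build _ _ _ _ _ mX).
pose Y' : {RV P' >-> R} := HB.pack Y (isMeasurableFun.Build _ _ _ _ _ mY).
pose m1 : probability R R := distribution P X'.
pose m2 : probability R R := distribution P' Y'.
have mfin (m : probability R R) B : measurable B -> (m B < +oo)%E.
  by move=> mB; rewrite (le_lt_trans (probability_le1 _ _))// ltry.
suff : m1 A = m2 A by [].
apply: (@measure_unique _ R _ (@ocitv R)
  (fun k : nat => `](- k%:R)%R, k%:R]%classic) _ _ _ _ m1 m2) => //.
- exact: ocitvI.
- by move=> k; exact: is_ocitv.
- rewrite -subTset => x _.
  have [k xk] : exists k : nat, `|x| < k%:R.
    by exists (Num.truncn `|x|).+1; exact: truncnS_gt.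
  exists k => //=; rewrite in_itv/=; move: xk; rewrite ltr_norml => /andP[-> /ltW ->].
  by [].
- move=> _ [[u v]] _ <-/=.
  have [uv|vu] := leP u v; last first.
    by rewrite set_itv_ge ?measure0// bnd_simp -leNgt ltW.
  have -> : (`]u, v] = `]-oo, v] `\` `]-oo, u] :> set R)%classic.
    apply/seteqP; split => x /=; rewrite !in_itv/=.
      by move=> /andP[ux xv]; split => //; apply/negP; rewrite -ltNge.
    by move=> [-> /negP]; rewrite -ltNge => ->.
  have mO (w : R) : measurable (`]-oo, w]%classic : set R) by [].
  have sub : (`]-oo, v] `&` `]-oo, u] = `]-oo, u] :> set R)%classic.
    apply/setIidPr => x /=; rewrite !in_itv/= => xu; exact: le_trans xu uv.
  rewrite !measureD ?mfin// sub.
  by congr (_ - _)%E; exact: XY.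
- by move=> k; exact: mfin.
Qed.

(** Both errors can be sent to 0 at every x, because the distribution function of [Y] is continuous
    from the right. *)
Lemma cdf_le_of_close d d' (T : measurableType d) (T' : measurableType d')
    (P : probability T R) (P' : probability T' R) (X : T -> R) (Y : T' -> R) x :
  measurable_fun setT X -> measurable_fun setT Y ->
  (forall e eta : R, (0 < e)%R -> (0 < eta)%R ->
    P (X @^-1` `]-oo, x]) <= P' (Y @^-1` `]-oo, (x + e)%R]) + eta%:E)%E ->
  (P (X @^-1` `]-oo, x]) <= P' (Y @^-1` `]-oo, x]))%E.
Proof.
move=> mX mY XY; apply/lee_addgt0Pr => eta eta0.
pose Y' : {RV P' >-> R} := HB.pack Y (isMeasurableFun.Build _ _ _ _ _ mY).
rewrite -leeBlDr//.
apply: (cvge_ge _ (@cdf_right_continuous _ _ _ _ Y' x)).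
near=> y; rewrite leeBlDr//.
have -> : y = x + (y - x) by rewrite addrC subrK.
by apply: XY => //; rewrite subr_gt0; near: y; exact: nbhs_right_gt.
Unshelve. all: by end_near. Qed.

Lemma markov_moment2 d (T : measurableType d) (P : probability T R) (X : T -> R) e :
  measurable_fun setT X -> 0 < e ->
  (P [set w | (e <= `|X w|)%R] <= (e ^- 2)%:E * moment2 P X)%E.
Proof.
move=> mX e0.
pose X' : {RV P >-> R} := HB.pack X (isMeasurableFun.Build _ _ _ _ _ mX).
have := @markov _ _ _ P X' (fun x => x ^+ 2) e e0.
move=> /(_ (measurable_funX _ _) (fun x _ => sqr_ge0 x)).
have h : {in Num.nneg &, {homo (fun x : R => x ^+ 2) : x y / x <= y}}.
  by move=> x y; rewrite !nnegrE => x0 y0 xy; exact: lerXn2r.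
move=> /(_ _ h); rewrite [X in (_ <= X)%E](_ : _ = moment2 P X); last first.
  by congr expectation; apply/funext => w /=; rewrite -normrX ger0_norm ?sqr_ge0.
rewrite -lee_pdivlMl ?exprn_gt0//; apply => //.
Qed.

(** All the approximants have the law of [X], so probabilities of events on [X'] are fixed
    quantities. Closeness in probability then compares the distribution functions of [X] and [Y] in
    both directions, up to a shift of the argument to the right. *)
Lemma same_law_limit d d' (T : measurableType d) (T' : measurableType d')
    (P : probability T R) (P' : probability T' R) (Y : T -> R) (X : T' -> R) :
  measurable_fun setT Y -> measurable_fun setT X ->
  (forall e : R, 0 < e -> exists X' : T -> R, [/\ measurable_fun setT X',
     same_law P P' X' X & (moment2 P (fun w => (X' w - Y w)%R) <= e%:E)%E]) ->
  same_law P P' Y X.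
Proof.
move=> mY mX YX; apply: same_law_cdf => // x.
have mpre (Z : T -> R) y : measurable_fun setT Z -> measurable (Z @^-1` `]-oo, y]).
  by move=> mZ; rewrite -[W in measurable W]setTI; exact: mZ.
have close (Z Z' : T -> R) y e : measurable_fun setT Z -> measurable_fun setT Z' ->
    0 < e -> (P (Z @^-1` `]-oo, y]) <= P (Z' @^-1` `]-oo, (y + e)%R]) +
      (e ^- 2)%:E * moment2 P (fun w => (Z w - Z' w)%R))%E.
  move=> mZ mZ' e0.
  have mB : measurable_fun setT (fun w => Z w - Z' w) by exact: measurable_funB.
  have mE : measurable [set w | e <= `|Z w - Z' w|].
    rewrite (_ : mkset _ = (fun w => `|Z w - Z' w|) @^-1` `[e, +oo[); last first.
      by apply/seteqP; split => w /=; rewrite in_itv/= andbT.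
    rewrite -[W in measurable W]setTI.
    by apply: (measurableT_comp _ mB) => //; exact: normr_measurable.
  apply: (@le_trans _ _ (P (Z' @^-1` `]-oo, (y + e)%R]) +
      P [set w | (e <= `|Z w - Z' w|)%R])%E); last first.
    by rewrite leeD2l//; exact: (markov_moment2 P mB e0).
  apply: (le_trans _ (measureU2 _ (mpre _ _ mZ') mE)).
  rewrite le_measure ?inE//; [exact: mpre|exact: (measurableU _ _ (mpre _ _ mZ') mE)|].
  move=> w /=; rewrite !in_itv/= => Zy.
  have [Zy'|Zy'] := leP (Z' w) (y + e); [by left|right].
  by rewrite ler0_norm; lra.
have sym (Z Z' : T -> R) : moment2 P (fun w => (Z w - Z' w)%R) =
    moment2 P (fun w => (Z' w - Z w)%R).
  by congr expectation; apply/funext => w /=; rewrite -sqrrN opprB.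
apply/eqP; rewrite eq_le; apply/andP; split.
- apply: cdf_le_of_close => // e eta e0 eta0.
  (* A second moment of at most [eta * e ^+ 2] makes the Markov bound at level [e] equal to at most
     [eta]. *)
  have ee : 0 < eta * e ^+ 2 by rewrite mulr_gt0 ?exprn_gt0.
  have [X' [mX' X'X X'Y]] := YX _ ee.
  rewrite -X'X//; apply: (le_trans (close Y X' x e mY mX' e0)); rewrite leeD2l// sym.
  apply: le_trans (lee_wpmul2l _ X'Y) _; first by rewrite lee_fin invr_ge0 exprn_ge0 ?ltW.
  by rewrite -EFinM lee_fin mulrC mulfK// gt_eqF ?exprn_gt0.
- apply: cdf_le_of_close => // e eta e0 eta0.
  have ee : 0 < eta * e ^+ 2 by rewrite mulr_gt0 ?exprn_gt0.
  have [X' [mX' X'X X'Y]] := YX _ ee.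
  rewrite -X'X//; apply: (le_trans (close X' Y x e mX' mY e0)); rewrite leeD2l//.
  apply: le_trans (lee_wpmul2l _ X'Y) _; first by rewrite lee_fin invr_ge0 exprn_ge0 ?ltW.
  by rewrite -EFinM lee_fin mulrC mulfK// gt_eqF ?exprn_gt0.
Qed.

End law_limit.

(** * Second moments *)

(** Meaningful on L^2 only: [fine] sends an infinite moment to 0. *)
Definition L2norm d (T : measurableType d) (R : realType)
    (P : probability T R) (X : T -> R) : R := Num.sqrt (fine (moment2 P X)).

Definition L2dot d (T : measurableType d) (R : realType)
    (P : probability T R) (X Y : T -> R) : R := \int[P]_w (X w * Y w).

Section L2.
Context d (T : measurableType d) (R : realType) (P : probability T R).
Implicit Types X Y : T -> R.

Lemma L2_measurable X : X \in Lfun P 2%:E -> measurable_fun setT X.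
Proof. by move=> /sub_Lfun_mfun; rewrite inE. Qed.

Lemma moment2_ge0 X : (0 <= moment2 P X)%E.
Proof. by apply: expectation_ge0 => w; exact: sqr_ge0. Qed.

(** The bridge to [Lnorm], through which membership in [Lfun] and the Minkowski and Hoelder
    inequalities are reached. *)
Lemma moment2_Lnorm X : ('N[P]_2%:E[EFin \o X] `^ 2 = moment2 P X)%E.
Proof.
rewrite powR_Lnorm ?pnatr_eq0// /moment2 unlock.
by apply: eq_integral => w _ /=; rewrite powR_mulrn// real_normK// num_real.
Qed.

Lemma moment2_Lfun X : measurable_fun setT X -> (moment2 P X < +oo)%E ->
  X \in Lfun P 2%:E.
Proof.
move=> mX X2; rewrite inE; apply/andP; split; rewrite inE//=.
rewrite /finite_norm; apply: (@lty_poweRy _ _ 2); first by rewrite pnatr_eq0.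
by rewrite moment2_Lnorm.
Qed.

Lemma moment2_lty X : X \in Lfun P 2%:E -> (moment2 P X < +oo)%E.
Proof.
move=> X2; rewrite -moment2_Lnorm poweR_lty//.
by move: X2; rewrite inE => /andP[_]; rewrite inE.
Qed.

Lemma L2norm_ge0 X : 0 <= L2norm P X. Proof. exact: sqrtr_ge0. Qed.

Lemma moment2E X : X \in Lfun P 2%:E -> moment2 P X = (L2norm P X ^+ 2)%:E.
Proof.
move=> X2; rewrite /L2norm sqr_sqrtr ?fine_ge0 ?moment2_ge0// fineK//.
by rewrite ge0_fin_numE ?moment2_ge0// moment2_lty.
Qed.

Lemma Lnorm2E X : X \in Lfun P 2%:E -> 'N[P]_2%:E[EFin \o X]%E = (L2norm P X)%:E.
Proof.
move=> X2; have := moment2_Lnorm X; rewrite moment2E//.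
have := Lnorm_ge0 P 2%:E (EFin \o X).
case: ('N[P]_2%:E[EFin \o X])%E => [r||]//.
  rewrite lee_fin => r0; rewrite poweR_EFin powR_mulrn// => -[] /eqP.
  by rewrite eqrXn2 ?L2norm_ge0// => /eqP ->.
by rewrite poweRyr ?pnatr_eq0.
Qed.

Lemma L2norm_le X (r : R) : 0 <= r -> (moment2 P X <= (r ^+ 2)%:E)%E -> L2norm P X <= r.
Proof.
move=> r0 Xr; rewrite /L2norm -[leRHS](ger0_norm r0) -sqrtr_sqr ler_wsqrtr//.
rewrite -lee_fin fineK// ge0_fin_numE ?moment2_ge0//.
exact: le_lt_trans Xr (ltry _).
Qed.

Lemma LfunD2 X Y : X \in Lfun P 2%:E -> Y \in Lfun P 2%:E ->
  (fun w => X w + Y w) \in Lfun P 2%:E.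
Proof. by move=> X2 Y2; apply: (@rpredD _ (Lfun P 2%:E) X Y); rewrite ?lee1n. Qed.

Lemma LfunB2 X Y : X \in Lfun P 2%:E -> Y \in Lfun P 2%:E ->
  (fun w => X w - Y w) \in Lfun P 2%:E.
Proof. by move=> X2 Y2; apply: (@rpredB _ (Lfun P 2%:E) X Y); rewrite ?lee1n. Qed.

Lemma LfunZ2 a X : X \in Lfun P 2%:E -> (fun w => a * X w) \in Lfun P 2%:E.
Proof.
move=> X2; have -> : (fun w => a * X w) = a \o* X by apply/funext => w /=; rewrite mulrC.
by apply: Lfun_scale => //; rewrite ler1n.
Qed.

Lemma Lfun2_Lfun1 X : X \in Lfun P 2%:E -> X \in Lfun P 1.
Proof. by move=> X2; exact: (Lfun_subset12 (fin_num_measure P _ measurableT) X2). Qed.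

Lemma L2norm_triangle X Y : X \in Lfun P 2%:E -> Y \in Lfun P 2%:E ->
  L2norm P (fun w => X w + Y w) <= L2norm P X + L2norm P Y.
Proof.
move=> X2 Y2; rewrite -lee_fin EFinD -!Lnorm2E//; last exact: LfunD2.
by apply: eminkowski; [exact: L2_measurable|exact: L2_measurable|rewrite lee1n].
Qed.

Lemma L2normZ a X : X \in Lfun P 2%:E -> L2norm P (fun w => a * X w) = `|a| * L2norm P X.
Proof.
move=> X2; apply/eqP; rewrite -(@eqrXn2 _ 2) ?mulr_ge0 ?L2norm_ge0//.
rewrite -eqe exprMn (EFinM (`|a| ^+ 2)) -!moment2E ?LfunZ2// real_normK ?num_real//.
rewrite /moment2 unlock -ge0_integralZl//.
- by apply/eqP/eq_integral => w _; rewrite exprMn EFinM.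
- by apply/measurable_EFinP; apply: measurable_funX; exact: L2_measurable.
- by move=> w _; rewrite lee_fin sqr_ge0.
- by rewrite lee_fin sqr_ge0.
Qed.

Lemma L2_cauchy_schwarz X Y : X \in Lfun P 2%:E -> Y \in Lfun P 2%:E ->
  (\int[P]_w `|X w * Y w|%:E <= (L2norm P X * L2norm P Y)%:E)%E.
Proof.
move=> X2 Y2; have := @hoelder _ _ _ P X Y 2 2.
rewrite Lnorm1 !Lnorm2E//; apply => //; try exact: L2_measurable.
by rewrite [RHS]splitr !div1r.
Qed.

Lemma L2_integrable X Y : X \in Lfun P 2%:E -> Y \in Lfun P 2%:E ->
  P.-integrable setT (fun w => (X w * Y w)%:E).
Proof. by move=> X2 Y2; apply/Lfun1_integrable/(Lfun2_mul_Lfun1 X2 Y2). Qed.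

Lemma normr_L2dot X Y : X \in Lfun P 2%:E -> Y \in Lfun P 2%:E ->
  `|L2dot P X Y| <= L2norm P X * L2norm P Y.
Proof.
move=> X2 Y2; rewrite -lee_fin; apply: le_trans (L2_cauchy_schwarz X2 Y2).
rewrite EFin_normr_Rintegral//; last exact: L2_integrable.
apply: (le_trans (le_abse_integral _ _ _)) => //.
by have /integrableP[] := L2_integrable X2 Y2.
Qed.

Lemma L2dotE X Y : X \in Lfun P 2%:E -> Y \in Lfun P 2%:E ->
  ('E_P[fun w => (X w * Y w)%R] = (L2dot P X Y)%:E)%E.
Proof.
move=> X2 Y2; rewrite unlock /L2dot /Rintegral fineK//.
by apply: integrable_fin_num => //; exact: L2_integrable.
Qed.

Lemma L2dotDZ X Y Z a b : X \in Lfun P 2%:E -> Y \in Lfun P 2%:E -> Z \in Lfun P 2%:E ->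
  L2dot P X (fun w => a * Y w + b * Z w) = a * L2dot P X Y + b * L2dot P X Z.
Proof.
move=> X2 Y2 Z2; rewrite /L2dot.
rewrite -!RintegralZl//; try exact: L2_integrable.
rewrite -RintegralD//; last 2 first.
- rewrite (_ : _ \o _ = (fun w => ((a * X w) * Y w)%:E)).
    by apply: L2_integrable => //; exact: LfunZ2.
  by apply/funext => w /=; rewrite mulrA.
- rewrite (_ : _ \o _ = (fun w => ((b * X w) * Z w)%:E)).
    by apply: L2_integrable => //; exact: LfunZ2.
  by apply/funext => w /=; rewrite mulrA.
by apply: eq_Rintegral => w _; ring.
Qed.

Lemma L2norm_sqrD X Y : X \in Lfun P 2%:E -> Y \in Lfun P 2%:E ->
  L2norm P (fun w => X w + Y w) ^+ 2 =
  L2norm P X ^+ 2 + 2 * L2dot P X Y + L2norm P Y ^+ 2.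
Proof.
move=> X2 Y2; have XY2 := LfunD2 X2 Y2.
apply/eqP; rewrite -eqe !EFinD -!moment2E// /moment2 unlock.
have iX := Lfun2_integrable_sqr X2; have iY := Lfun2_integrable_sqr Y2.
have iXY := L2_integrable X2 Y2.
rewrite EFinM /L2dot /Rintegral fineK; last exact: integrable_fin_num.
rewrite -integralZl// -integralD//; last first.
  exact: (integrableZl measurableT 2 iXY).
rewrite -integralD//; last first.
  by apply: integrableD => //; exact: (integrableZl measurableT 2 iXY).
apply/eqP; apply: eq_integral => w _; rewrite -!EFinM -!EFinD; congr EFin; ring.
Qed.

End L2.

Section L2_sums.
Context d (T : measurableType d) (R : realType) (P : probability T R).
Context (I : Type) (f : I -> T -> R).
Hypothesis f2 : forall i, f i \in Lfun P 2%:E.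

Lemma Lfun2_sum (s : seq I) : (fun w => \sum_(i <- s) f i w) \in Lfun P 2%:E.
Proof.
elim: s => [|i s IHs]; first by under eq_fun do rewrite big_nil; exact: Lfun_cst.
by under eq_fun do rewrite big_cons; exact: LfunD2.
Qed.

Lemma expectation_sum2 (s : seq I) :
  ('E_P[fun w => (\sum_(i <- s) f i w)%R] = \sum_(i <- s) 'E_P[f i])%E.
Proof.
elim: s => [|i s IHs].
  by rewrite big_nil; under eq_fun do rewrite big_nil; exact: expectation_cst.
rewrite big_cons -IHs; under eq_fun do rewrite big_cons.
rewrite -expectationD//; first exact: Lfun2_Lfun1.
by apply: Lfun2_Lfun1; exact: Lfun2_sum.
Qed.

End L2_sums.

(* Rescaled to the second moment of the limit, the approximating variables all
   have the same law, which the limit then inherits. *)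
Lemma centered_normal_limit d (T : measurableType d) (R : realType)
    (P : probability T R) (Y : T -> R) : Y \in Lfun P 2%:E ->
  (forall e : R, 0 < e -> exists X : T -> R, centered_normal P X /\
     L2norm P (fun w => X w - Y w) <= e) ->
  centered_normal P Y.
Proof.
move=> Y2 YX; have mY := L2_measurable Y2.
suff [X [X0 YX0]] : exists X, centered_normal P X /\ same_law P P Y X.
  have [X2 EX nX] := X0; have mX := L2_measurable X2.
  split => //; first by rewrite -EX unlock; exact: (same_law_integral (f := @EFin R)).
  have [c [s [s0 XZ]]] := is_normal_affine nX.
  by apply: (affine_is_normal mY s0) => A mA; rewrite (YX0 _ mA) (XZ _ mA).
(* A null [Y] cannot be reached by rescaling to its norm; it is compared with the constant 0, which
   is centered normal as a multiple of some approximant. *)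
have [v0|v0] := eqVneq (L2norm P Y) 0.
  exists (cst 0); have c0 : centered_normal P (cst 0).
    have [X [X0 _]] := YX 1 ltr01.
    rewrite (_ : cst 0 = (fun w => 0 * X w)); first exact: centered_normalZ.
    by apply/funext => w; rewrite mul0r.
  split => //; apply: same_law_limit => // e e0; exists (cst 0); split => //.
  rewrite (_ : (fun w => _) = (fun w => (-1) * Y w)); last first.
    by apply/funext => w /=; rewrite sub0r mulN1r.
  by rewrite moment2E ?LfunZ2// L2normZ// v0 mulr0 expr0n/= lee_fin ltW.
have {}v0 : 0 < L2norm P Y by rewrite lt_neqAle eq_sym v0 L2norm_ge0.
set v := L2norm P Y in v0 *.
have approx e : 0 < e -> exists X, [/\ centered_normal P X, L2norm P X = v &
    L2norm P (fun w => X w - Y w) <= e].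
  (* The bound v/2 keeps the norm of [X] positive, so that it can be divided by. One half of [e]
     pays for X - Y, the other for the rescaling, which moves [X] by the difference of the two
     norms. *)
  move=> e0; pose e' := Num.min (e / 2) (v / 2).
  have e'0 : 0 < e' by rewrite lt_min !divr_gt0.
  have [X [X0 XY]] := YX _ e'0; have [X2 _ _] := X0.
  have XY2 := LfunB2 X2 Y2.
  have Xv : `|v - L2norm P X| <= e'.
    rewrite ler_distl; apply/andP; split.
      have := L2norm_triangle Y2 XY2.
      rewrite (_ : (fun w => Y w + _) = X); last by apply/funext => w; rewrite addrC subrK.
      by rewrite -/v; lra.
    have := L2norm_triangle X2 (LfunZ2 (-1) XY2); rewrite L2normZ// normrN1 mul1r.
    rewrite (_ : (fun w => X w + _) = Y); last by apply/funext => w; ring.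
    by rewrite -/v; lra.
  have [e'e e'v] : e' <= e / 2 /\ e' <= v / 2 by rewrite !ge_min !lexx orbT.
  have X0' : 0 < L2norm P X by move: Xv; rewrite ler_norml => /andP[]; lra.
  exists (fun w => v / L2norm P X * X w); split.
  - by apply: centered_normalZ => //; rewrite divr_ge0// ltW.
  - by rewrite L2normZ// ger0_norm ?divr_ge0 ?ltW// divfK// gt_eqF.
  - have := L2norm_triangle (LfunZ2 (v / L2norm P X - 1) X2) XY2.
    rewrite (_ : (fun w => _ + _) = (fun w => v / L2norm P X * X w - Y w)); last first.
      by apply/funext => w; ring.
    move=> /le_trans; apply; rewrite L2normZ//.
    rewrite -[X in _ * X]ger0_norm ?L2norm_ge0// -normrM mulrBl divfK ?gt_eqF// mul1r.
    lra.
(* Any accuracy would do: only the law of [X0], common to all rescaled approximants, matters. *)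
have [X0 [cX0 X0v _]] := approx 1 ltr01.
have [X02 _ _] := cX0.
exists X0; split => //; apply: same_law_limit => //; first exact: (L2_measurable X02).
move=> e e0; have se0 : 0 < Num.sqrt e by rewrite sqrtr_gt0.
have [X [cX Xv XY]] := approx _ se0; have [X2 _ _] := cX.
exists X; split; first exact: (L2_measurable X2).
- by apply: centered_normal_unique => //; rewrite !moment2E// Xv X0v.
- rewrite moment2E ?LfunB2// lee_fin -[leRHS](sqr_sqrtr (ltW e0)).
  by rewrite ler_pXn2r ?nnegrE ?L2norm_ge0 ?sqrtr_ge0.
Qed.

(** * Path integrals of Gaussian processes *)

Section process.
Context d (Omega : measurableType d) (R : realType) (P : probability Omega R).
Context d' (U : measurableType d') (mu : {finite_measure set U -> \bar R}).
Variable H : Omega * U -> R.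
Hypothesis mH : measurable_fun setT H.
Hypothesis H2 : forall p, (fun w => H (w, p)) \in Lfun P 2%:E.

Definition sd (p : U) : R := L2norm P (fun w => H (w, p)).

Let mHw w : measurable_fun setT (fun p => H (w, p)).
Proof. exact: (measurableT_comp mH). Qed.

Let mabsH : measurable_fun setT (fun wp => `|H wp|%:E).
Proof. by apply/measurable_EFinP; exact: measurableT_comp. Qed.

Lemma measurable_sd : measurable_fun setT sd.
Proof.
have mf : measurable_fun setT (fun wp => (H wp ^+ 2)%:E).
  by apply/measurable_EFinP; exact: measurable_funX.
have mG := measurable_fun_fubini_tonelli_G (m1 := P) _ mf (fun wp => _).
rewrite /sd /L2norm /moment2 unlock.
apply: (measurableT_comp (continuous_measurable_fun (@sqrt_continuous R))).
apply: (measurableT_comp (fine_measurable measurableT)).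
by apply: mG => wp; rewrite lee_fin sqr_ge0.
Qed.

Let J (w : Omega) : \bar R := (\int[mu]_p `|H (w, p)|%:E)%E.

Let mJ : measurable_fun setT J.
Proof. by apply: (measurable_fun_fubini_tonelli_F (m2 := mu) _ mabsH) => wp; rewrite lee_fin. Qed.

Let J0 w : (0 <= J w)%E. Proof. by apply: integral_ge0 => p _; rewrite lee_fin. Qed.

(** * Integrability of the standard deviation *)

Section integrable_sd.
Hypothesis HN : forall p, centered_normal P (fun w => H (w, p)).
Hypothesis iH : forall w, mu.-integrable setT (fun p => (H (w, p))%:E).

Let Jy w : (J w < +oo)%E.
Proof. by have /integrableP[] := iH w. Qed.

(* All the H p / sd p with sd p != 0 have the same atomless law, whence a common
   delta. *)
Lemma small_ball_sd : exists2 delta : R, 0 < delta & forall p,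
  (P [set w | (`|H (w, p)| <= delta * sd p)%R] <= (2^-1)%:E)%E \/ sd p = 0.
Proof.
(* The common law is read off at one reference point [p0]; without such a point every delta
   works. *)
have [[p0 s0]|s0] := pselect (exists p, sd p != 0); last first.
  exists 1 => // p; right; apply/eqP/negPn/negP => sp; apply: s0; by exists p.
have sd_gt0 p : sd p != 0 -> 0 < sd p by rewrite lt_neqAle eq_sym L2norm_ge0 andbT.
pose X p w := (sd p)^-1 * H (w, p).
have X0 p : centered_normal P (X p).
  by apply: centered_normalZ => //; rewrite invr_ge0 L2norm_ge0.
have X1 p : sd p != 0 -> moment2 P (X p) = 1%:E.
  move=> sp; have [Xp2 _ _] := X0 p; rewrite moment2E// L2normZ//.
  by rewrite ger0_norm ?invr_ge0 ?L2norm_ge0// mulVf// expr1n.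
have mX p : measurable_fun setT (X p) by have [_ _ []] := X0 p.
have mabs r : measurable [set x : R | `|x| <= r].
  rewrite (_ : mkset _ = `[- r, r]%classic)//.
  by apply/seteqP; split => x /=; rewrite in_itv/= ler_norml.
(* These events decrease to the null event X p0 = 0, so one of them has probability below 1/2. *)
pose F (n : nat) := X p0 @^-1` [set x : R | `|x| <= n.+1%:R^-1].
have mF n : measurable (F n) by rewrite -[W in measurable W]setTI; exact: mX.
have FE : \bigcap_n F n = X p0 @^-1` [set 0].
  apply/seteqP; split => [w Fw|w /= Xw n _]; last by rewrite /F/= Xw normr0 invr_ge0.
  apply/eqP; rewrite -normr_le0; apply/ler_addgt0Pl => e e0; rewrite addr0.
  have [n ne] : exists n : nat, e^-1 < n%:R by exists (Num.truncn e^-1).+1; exact: truncnS_gt.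
  have := Fw n I; rewrite /F/= => /le_trans; apply.
  rewrite -[leRHS]invrK lef_pV2 ?posrE ?invr_gt0//.
  by rewrite (le_trans (ltW ne))// ler_nat.
have F0 : P (\bigcap_n F n) = 0%E.
  rewrite FE; apply: centered_normal_atomless => //.
  by rewrite X1// eqe oner_neq0.
have : P \o F @ \oo --> 0%E.
  rewrite -F0; apply: nonincreasing_cvg_mu => //.
  - by rewrite (le_lt_trans (probability_le1 _ _))// ltry.
  - exact: bigcap_measurable.
  - apply/nonincreasing_seqP => n; apply/subsetPset => w; rewrite /F/= => /le_trans; apply.
    by rewrite lef_pV2 ?posrE// ler_nat.
move=> /fine_cvgP[_] /cvgrPdist_lt /(_ 2^-1); rewrite invr_gt0 => /(_ (ltr0Sn _ _)).
move=> [n _ /(_ n (leqnn _))/=]; rewrite sub0r normrN ger0_norm ?fine_ge0// => Fn.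
exists n.+1%:R^-1; first by rewrite invr_gt0.
move=> p; have [sp|sp] := eqVneq (sd p) 0; [by right|left].
rewrite (_ : mkset _ = X p @^-1` [set x : R | `|x| <= n.+1%:R^-1]); last first.
  apply/seteqP; split => w /=; rewrite /X normrM ger0_norm ?invr_ge0 ?L2norm_ge0//;
  by rewrite ler_pdivrMl ?sd_gt0// mulrC.
rewrite (centered_normal_unique (X0 p) (X0 p0) _ (mabs _)); last by rewrite !X1.
have Pf : P (F n) \is a fin_num by exact: fin_num_measure.
by change (P (F n) <= (2^-1)%:E)%E; rewrite -(fineK Pf) lee_fin ltW.
Qed.

Lemma integrable_sd : mu.-integrable setT (EFin \o sd).
Proof.
have [delta delta0 small] := small_ball_sd.
pose A (n : nat) := [set w | J w <= n%:R%:E]%E.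
have mA n : measurable (A n).
  rewrite -[A n]setTI; apply: (emeasurable_fun_infty_c measurableT mJ).
have [n An] : exists n, ((3 / 4)%:E <= P (A n))%E.
  have AT : \bigcup_n A n = setT.
    rewrite -subTset => w _; have := Jy w; have := J0 w.
    case Jw : (J w) => [r||]// _ _.
    exists (Num.truncn r).+1 => //=; rewrite /A/= Jw lee_fin ltW//.
    exact: truncnS_gt.
  have : P \o A @ \oo --> 1%E.
    rewrite -(probability_setT P) -AT; apply: nondecreasing_cvg_mu => //.
    - exact: bigcup_measurable.
    - apply/nondecreasing_seqP => n; apply/subsetPset => w; rewrite /A/= => /le_trans; apply.
      by rewrite lee_fin ler_nat.
  move=> /fine_cvgP[_] /cvgrPdist_lt /(_ 4^-1); rewrite invr_gt0 => /(_ (ltr0Sn _ _)).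
  move=> [n _ /(_ n (leqnn _))/=]; rewrite ltr_norml => /andP[_ h].
  exists n; rewrite -[leRHS]fineK ?fin_num_measure// lee_fin; lra.
(* The small-ball event has probability at most 1/2 and [A n] at least 3/4, which leaves a part of
   [A n] of probability at least 1/4 where |H p| exceeds delta sd(p). *)
have lower p : ((delta * sd p / 4)%:E <= \int[P]_w (\1_(A n) w * `|H (w, p)|)%:E)%E.
  have [small_p|->] := small p; last first.
    by rewrite mulr0 mul0r integral_ge0// => w _; rewrite lee_fin mulr_ge0.
  set B := [set w | _] in small_p.
  have mB : measurable B.
    rewrite (_ : B = (fun w => H (w, p)) @^-1` `[- (delta * sd p), delta * sd p]); last first.
      by apply/seteqP; split => w /=; rewrite /B/= in_itv/= ler_norml.
    by rewrite -[W in measurable W]setTI; exact: (L2_measurable (H2 p)).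
  have PAB : ((4^-1)%:E <= P (A n `\` B))%E.
    have : ((3 / 4)%:E <= P (A n `\` B) + (2^-1)%:E)%E.
      apply: (le_trans An); apply: (@le_trans _ _ (P (A n `\` B) + P B)%E); last by rewrite leeD2l.
      apply: le_trans (measureU2 _ _ _) => //; last exact: measurableD.
      rewrite le_measure ?inE//; first by apply: measurableU => //; exact: measurableD.
      by move=> w Aw; have [Bw|Bw] := pselect (B w); [right|left].
    rewrite -leeBlDr// -EFinB; apply: le_trans; rewrite lee_fin; lra.
  have sp0 : 0 <= delta * sd p by rewrite mulr_ge0 ?L2norm_ge0// ltW.
  apply: (@le_trans _ _ ((delta * sd p)%:E * P (A n `\` B))%E).
    by rewrite EFinM lee_wpmul2l// lee_fin.
  rewrite -(setIT (A n `\` B)) -integral_indic//; last exact: measurableD.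
  rewrite -ge0_integralZl//; last first.
    by apply/measurable_EFinP; apply: measurable_indic; exact: measurableD.
  apply: ge0_le_integral => //.
  - by move=> w _; rewrite -EFinM lee_fin mulr_ge0.
  - apply/measurable_EFinP; apply: measurable_funM => //.
    by apply: measurable_indic; exact: measurableD.
  - apply/measurable_EFinP; apply: measurable_funM; first exact: measurable_indic.
    by apply: measurableT_comp => //; exact: (L2_measurable (H2 p)).
  move=> w _; rewrite -EFinM lee_fin !indicE.
  have [|] := boolP (w \in A n `\` B); last by rewrite mulr0 mulr_ge0.
  by rewrite inE => -[Aw /negP]; rewrite -ltNge mem_set// mul1r mulr1 => /ltW.
have mf1 : measurable_fun setT (fun wp : Omega * U => (\1_(A n) wp.1 * `|H wp|)%:E).
  apply/measurable_EFinP; apply: measurable_funM.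
    by apply: (measurableT_comp (measurable_indic (mA n))).
  by apply: measurableT_comp.
(* By Tonelli, the inner integral becomes [J w] on [A n], where it is at most n. *)
have upper : (\int[mu]_p \int[P]_w (\1_(A n) w * `|H (w, p)|)%:E <= n%:R%:E)%E.
  rewrite -(fubini_tonelli (m1 := P) _ mf1); last first.
    by move=> wp; rewrite lee_fin mulr_ge0.
  apply: (@le_trans _ _ (\int[P]_w (cst n%:R%:E w))%E); last first.
    by rewrite integral_cst//= probability_setT mule1.
  apply: ge0_le_integral => //.
  - by move=> w _; apply: integral_ge0 => p _; rewrite lee_fin mulr_ge0.
  - apply: (measurable_fun_fubini_tonelli_F (m2 := mu) _ mf1).
    by move=> wp; rewrite lee_fin mulr_ge0.
  move=> w _ /=; under eq_integral do rewrite EFinM.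
  rewrite ge0_integralZl//; last by apply: (measurableT_comp mabsH).
  rewrite indicE; have [|] := boolP (w \in A n); last by rewrite mul0e.
  by rewrite inE mul1e.
have msd := measurable_sd.
apply/integrableP; split; first exact/measurable_EFinP.
have d40 : 0 < delta / 4 by rewrite divr_gt0.
rewrite -(@lte_pmul2l _ (delta / 4)%:E) ?fin_numE// ?lte_fin//.
rewrite -ge0_integralZl//; last 2 first.
- by apply/measurable_EFinP; exact: measurableT_comp.
- by rewrite lee_fin ltW.
rewrite (mulry) gtr0_sg// mul1e.
apply: (@le_lt_trans _ _ n%:R%:E); last exact: ltry.
apply: le_trans upper; apply: ge0_le_integral => //.
- by move=> p _; rewrite -EFinM lee_fin mulr_ge0// ltW.
- apply/measurable_EFinP; apply: measurable_funM => //.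
  exact: measurableT_comp.
- apply: (measurable_fun_fubini_tonelli_G (m1 := P) _ mf1).
  by move=> wp; rewrite lee_fin mulr_ge0.
- move=> p _ /=; apply: le_trans (lower p); rewrite -EFinM lee_fin.
  by rewrite ger0_norm ?L2norm_ge0// mulrAC.
Qed.

End integrable_sd.

(** * The path integral as an element of L^2 *)

Section path_integral.
Hypothesis isd : mu.-integrable setT (EFin \o sd).
Hypothesis iH : forall w, mu.-integrable setT (fun p => (H (w, p))%:E).

Definition path_integral (w : Omega) : R := \int[mu]_p H (w, p).

Lemma sd_ge0 p : 0 <= sd p. Proof. exact: L2norm_ge0. Qed.

Definition total_sd : R := \int[mu]_p sd p.

Lemma total_sd_ge0 : 0 <= total_sd.
Proof. by apply: Rintegral_ge0 => p _; exact: sd_ge0. Qed.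

Lemma total_sdE : (\int[mu]_p (sd p)%:E = total_sd%:E)%E.
Proof. by rewrite /total_sd /Rintegral fineK//; exact: integrable_fin_num. Qed.

(** Cauchy-Schwarz at each p bounds the expectation by a multiple of [sd p]. This justifies Fubini
    in [L2dot_path_integral]. *)
Lemma integrable_product (xi : Omega -> R) : xi \in Lfun P 2%:E ->
  (P \x mu)%E.-integrable setT (fun wp => (xi wp.1 * H wp)%:E).
Proof.
move=> xi2; have mxi := L2_measurable xi2.
have mf : measurable_fun setT (fun wp : Omega * U => (xi wp.1 * H wp)%:E).
  by apply/measurable_EFinP; apply: measurable_funM => //; exact: (measurableT_comp mxi).
apply/integrable21ltyP => //.
apply: (@le_lt_trans _ _ (\int[mu]_p ((L2norm P xi)%:E * (sd p)%:E))%E); last first.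
  rewrite ge0_integralZl//; last 3 first.
  - by apply/measurable_EFinP; exact: measurable_sd.
  - by move=> p _; rewrite lee_fin sd_ge0.
  - by rewrite lee_fin L2norm_ge0.
  by rewrite total_sdE -EFinM ltry.
apply: ge0_le_integral => //.
- by move=> p _; apply: integral_ge0.
- apply: (measurable_fun_fubini_tonelli_G (m1 := P)
    (abse \o (fun wp : Omega * U => (xi wp.1 * H wp)%:E))) => //.
    exact: measurableT_comp.
  by move=> wp; exact: abse_ge0.
- by apply: emeasurable_funM => //; apply/measurable_EFinP; exact: measurable_sd.
- by move=> p _; rewrite -EFinM; exact: L2_cauchy_schwarz.
Qed.

Lemma path_integralE w : (\int[mu]_p (H (w, p))%:E = (path_integral w)%:E)%E.
Proof. by rewrite /path_integral /Rintegral fineK//; exact: integrable_fin_num. Qed.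

Lemma measurable_path_integral : measurable_fun setT path_integral.
Proof.
have c1 : cst 1 \in Lfun P 2%:E by exact: Lfun_cst.
have := measurable_fubini_F (integrable_product c1).
rewrite /fubini_F; under eq_fun do under eq_integral do rewrite mul1r.
by under eq_fun do rewrite path_integralE; move/measurable_EFinP.
Qed.

(** This is the integral form of the Minkowski inequality. The path integral is dominated by [J],
    and Tonelli expands the expectation of J^2 one factor at a time, with Cauchy-Schwarz for each
    pair of points. *)
Lemma moment2_path_integral : (moment2 P path_integral <= (total_sd ^+ 2)%:E)%E.
Proof.
have S0 := total_sd_ge0.
have JH p : (\int[P]_w (J w * `|H (w, p)|%:E) <= (total_sd * sd p)%:E)%E.
  have mf : measurable_fun setT (fun ws : Omega * U => (`|H ws| * `|H (ws.1, p)|)%:E).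
    apply/measurable_EFinP; apply: measurable_funM; first exact: measurableT_comp.
    apply: measurableT_comp => //.
    exact: (measurableT_comp (L2_measurable (H2 p))).
  have f0 ws : (0 <= (`|H ws| * `|H (ws.1, p)|)%:E)%E by rewrite lee_fin mulr_ge0.
  under eq_integral => w _.
    rewrite /J -ge0_integralZr//; last by apply: (measurableT_comp mabsH).
    over.
  rewrite (fubini_tonelli (m1 := P) _ mf f0).
  rewrite EFinM -total_sdE -ge0_integralZr//; last 3 first.
  - by apply/measurable_EFinP; exact: measurable_sd.
  - by move=> s _; rewrite lee_fin sd_ge0.
  - by rewrite lee_fin sd_ge0.
  apply: ge0_le_integral => //.
  - by move=> s _; exact: integral_ge0.
  - exact: (measurable_fun_fubini_tonelli_G (m1 := P) _ mf f0).
  - by apply: emeasurable_funM => //; apply/measurable_EFinP; exact: measurable_sd.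
  - move=> s _; rewrite -EFinM; apply: le_trans (L2_cauchy_schwarz (H2 s) (H2 p)).
    by under eq_integral do rewrite -normrM.
have mf : measurable_fun setT (fun wp : Omega * U => J wp.1 * `|H wp|%:E)%E.
  by apply: emeasurable_funM => //; exact: (measurableT_comp mJ).
have f0 (wp : Omega * U) : (0 <= J wp.1 * `|H wp|%:E)%E by rewrite mule_ge0// lee_fin.
apply: (@le_trans _ _ (\int[P]_w (J w * J w))%E); last first.
  under eq_integral => w _.
    rewrite {2}/J -ge0_integralZl//; last by apply: (measurableT_comp mabsH).
    over.
  rewrite (fubini_tonelli (m1 := P) _ mf f0).
  rewrite expr2 EFinM -{2}total_sdE -ge0_integralZl//; last 2 first.
  - by apply/measurable_EFinP; exact: measurable_sd.
  - by move=> s _; rewrite lee_fin sd_ge0.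
  apply: ge0_le_integral => //.
  - by move=> p _; exact: integral_ge0.
  - exact: (measurable_fun_fubini_tonelli_G (m1 := P) _ mf f0).
  - by apply: emeasurable_funM => //; apply/measurable_EFinP; exact: measurable_sd.
rewrite /moment2 unlock; apply: ge0_le_integral => //.
- by move=> w _; rewrite lee_fin sqr_ge0.
- by apply/measurable_EFinP; apply: measurable_funX; exact: measurable_path_integral.
- exact: emeasurable_funM.
move=> w _; have IJ : (`|path_integral w|%:E <= J w)%E.
  rewrite /path_integral EFin_normr_Rintegral//; last exact: iH.
  by apply: (le_trans (le_abse_integral _ _ _)) => //; apply/measurable_EFinP.
rewrite -real_normK ?num_real// expr2 EFinM.
by apply: lee_pmul => //; rewrite lee_fin.
Qed.

Lemma path_integral_L2 : path_integral \in Lfun P 2%:E.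
Proof.
apply: moment2_Lfun; first exact: measurable_path_integral.
exact: le_lt_trans moment2_path_integral (ltry _).
Qed.

Lemma L2norm_path_integral : L2norm P path_integral <= total_sd.
Proof. by apply: L2norm_le; [exact: total_sd_ge0|exact: moment2_path_integral]. Qed.

Let dotE xi p : xi \in Lfun P 2%:E ->
  (\int[P]_w (xi w * H (w, p))%:E = (L2dot P xi (fun w => H (w, p)))%:E)%E.
Proof. by move=> xi2; rewrite -L2dotE// unlock. Qed.

Lemma integrable_L2dot xi : xi \in Lfun P 2%:E ->
  mu.-integrable setT (fun p => (L2dot P xi (fun w => H (w, p)))%:E).
Proof.
move=> xi2; apply: (le_integrable _ _ _ (integrableZl measurableT (L2norm P xi) isd)) => //.
  have := measurable_fubini_G (integrable_product xi2).
  rewrite /fubini_G; apply: eq_measurable_fun => p _; exact: dotE.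
move=> p _; apply: (@le_trans _ _ (L2norm P xi * sd p)%:E).
  by rewrite lee_fin; exact: normr_L2dot.
by rewrite lee_fin; exact: ler_norm.
Qed.

(** The path integral is the weak integral in L^2 of the curve p -> H p; both the choice of descent
    points and the covariances rely on this. *)
Lemma L2dot_path_integral xi : xi \in Lfun P 2%:E ->
  L2dot P xi path_integral = \int[mu]_p L2dot P xi (fun w => H (w, p)).
Proof.
move=> xi2; rewrite {1}/L2dot /Rintegral; congr fine.
have := Fubini (integrable_product xi2) => /=.
under eq_integral => w _.
  under eq_integral do rewrite EFinM.
  rewrite integralZl// path_integralE -EFinM.
  over.
move=> ->; apply: eq_integral => p _; exact: dotE.
Qed.

End path_integral.
End process.

(** * Normality of the path integral *)

Section gaussian_path_integral.
Context d (Omega : measurableType d) (R : realType) (P : probability Omega R).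
Context d' (U : measurableType d') (mu : {finite_measure set U -> \bar R}).
Variable H : Omega * U -> R.
Hypothesis mH : measurable_fun setT H.
Hypothesis mu0 : mu setT != 0%E.
Hypothesis H2 : forall p, (fun w => H (w, p)) \in Lfun P 2%:E.
Hypothesis EH : forall p, 'E_P[fun w => H (w, p)]%E = 0%E.
Hypothesis iH : forall w, mu.-integrable setT (fun p => (H (w, p))%:E).
Hypothesis gH : forall (N : nat) (p : 'I_N -> U) (a : 'I_N -> R),
  is_normal P (fun w => \sum_k a k * H (w, p k)).

Local Notation sigma := (sd P H).
Local Notation I := (path_integral mu H).

Lemma centered_normal_lincomb (s : seq U) (c : U -> R) :
  centered_normal P (fun w => \sum_(q <- s) c q * H (w, q)).
Proof.
have cH2 q : (fun w => c q * H (w, q)) \in Lfun P 2%:E by exact: LfunZ2.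
split; first exact: Lfun2_sum.
- rewrite expectation_sum2// big1// => q _.
  have -> : (fun w => c q * H (w, q)) = c q \o* (fun w => H (w, q)).
    by apply/funext => w /=; rewrite mulrC.
  by rewrite expectationZl ?EH ?mule0//; exact: Lfun2_Lfun1.
(* Indexing by position allows repeated points in [s], which the greedy choice may produce. *)
- rewrite (_ : (fun w => _) = fun w => \sum_(k < size s)
      c (tnth (in_tuple s) k) * H (w, tnth (in_tuple s) k)); first exact: gH.
  by apply/funext => w; rewrite big_tnth.
Qed.

Let HN p : centered_normal P (fun w => H (w, p)).
Proof.
have := centered_normal_lincomb [:: p] (cst 1).
by under eq_fun do rewrite big_seq1 mul1r.
Qed.

Lemma integrable_sd_gaussian : mu.-integrable setT (EFin \o sigma).
Proof. exact: integrable_sd. Qed.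

Let isd := integrable_sd_gaussian.
Let I2 : I \in Lfun P 2%:E. Proof. exact: path_integral_L2. Qed.

Let S : R := \int[mu]_p (sigma p + 1).

Let i1 : mu.-integrable setT (EFin \o cst (1 : R)).
Proof. exact: finite_measure_integrable_cst. Qed.

Let SE : S = total_sd P mu H + fine (mu setT).
Proof. by rewrite /S RintegralD// Rintegral_cst// mul1r. Qed.

Let sS : total_sd P mu H <= S.
Proof. by rewrite SE lerDl fine_ge0. Qed.

Let S0 : 0 <= S.
Proof. exact: le_trans (total_sd_ge0 _ _ _) sS. Qed.

(* The errors [Y q] average to zero when q has density proportional to
   [sigma + 1]; the summand 1 avoids dividing by zero. *)
Let Y (q : U) (w : Omega) : R := S / (sigma q + 1) * H (w, q) - I w.

Let w0 q : 0 < sigma q + 1. Proof. by rewrite ltr_wpDl// L2norm_ge0. Qed.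

Let Y2 q : Y q \in Lfun P 2%:E.
Proof. by apply: LfunB2 => //; exact: LfunZ2. Qed.

(** Each of the two terms has norm at most S: the factor sigma / (sigma + 1) is at most 1, and the
    norm of [I] is at most [total_sd]. *)
Let Y_le q : L2norm P (Y q) <= 2 * S.
Proof.
have -> : Y q = fun w => S / (sigma q + 1) * H (w, q) + (-1) * I w.
  by apply/funext => w; rewrite /Y mulN1r.
rewrite (le_trans (L2norm_triangle _ _))//; [exact: LfunZ2|exact: LfunZ2|].
rewrite !L2normZ// normrN1 mul1r mulr_natl mulr2n lerD//.
  rewrite ger0_norm; last by rewrite divr_ge0// ltW.
  rewrite -mulrA ler_piMr// mulrC ler_pdivrMr// mul1r lerDl//.
by apply: le_trans sS; exact: L2norm_path_integral.
Qed.

(** Weighted by sigma + 1, the inner products with [Y q] integrate to 0. If all were positive, the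
    weighted function would be positive everywhere and yet vanish almost everywhere, against
    [mu0]. *)
Lemma exists_descent_point (e : Omega -> R) : e \in Lfun P 2%:E ->
  exists q, L2dot P e (Y q) <= 0.
Proof.
move=> e2; apply: contrapT => noq.
have pos q : 0 < S * L2dot P e (fun w => H (w, q)) - L2dot P e I * (sigma q + 1).
  have : 0 < L2dot P e (Y q) by rewrite ltNge; apply/negP => h; apply: noq; exists q.
  have -> : Y q = fun w => S / (sigma q + 1) * H (w, q) + (-1) * I w.
    by apply/funext => w; rewrite /Y mulN1r.
  rewrite L2dotDZ// => dpos; have := mulr_gt0 dpos (w0 q).
  by congr (0 < _); field; rewrite gt_eqF.
(* This is [L2dot P e (Y q)] multiplied by [sigma q + 1]. *)
pose g q := S * L2dot P e (fun w => H (w, q)) - L2dot P e I * (sigma q + 1).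
have idot := integrable_L2dot mH H2 isd e2.
have iw : mu.-integrable setT (EFin \o (fun q => sigma q + 1)).
  exact: (integrableD measurableT isd i1).
have ia : mu.-integrable setT (fun q => (S * L2dot P e (fun w => H (w, q)))%:E).
  exact: (integrableZl measurableT S idot).
have ib : mu.-integrable setT (fun q => (L2dot P e I * (sigma q + 1))%:E).
  exact: (integrableZl measurableT (L2dot P e I) iw).
have ig : mu.-integrable setT (EFin \o g) by exact: (integrableB measurableT ia ib).
have g0 : \int[mu]_q g q = 0.
  rewrite /g RintegralB//  !RintegralZl// -/S.
  by rewrite -(L2dot_path_integral mH H2 isd iH e2) mulrC subrr.
have : ae_eq mu setT (EFin \o g) (cst 0%E).
  apply/ae_eq_integral_abs => //; first by case/integrableP: ig.
  transitivity (\int[mu]_q (g q)%:E)%E.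
    by apply: eq_integral => q _; rewrite /= ger0_norm//; exact: ltW (pos q).
  by rewrite -[LHS]fineK ?integrable_fin_num// -/(Rintegral _ _ _) g0.
move=> [A [mA A0 subA]].
have AT : A = setT.
  rewrite -subTset => q _; apply: subA => /= /(_ Logic.I) [] gq0.
  by have : 0 < g q by [exact: pos]; rewrite gq0 ltxx.
by move: mu0; rewrite -AT A0 eqxx.
Qed.

(** At a descent point the cross term is nonpositive, so each new point adds at most (2S)^2 to the
    squared norm. *)
Lemma exists_greedy_points (N : nat) : exists s : seq U, size s = N /\
  L2norm P (fun w => \sum_(q <- s) Y q w) ^+ 2 <= N%:R * (2 * S) ^+ 2.
Proof.
have sum2 (s : seq U) := Lfun2_sum Y2 s.
elim: N => [|N [s [sN IHs]]].
  exists [::]; split => //; under eq_fun do rewrite big_nil.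
  have -> : (fun=> 0) = fun w : Omega => 0 * I w by apply/funext => w; rewrite mul0r.
  by rewrite L2normZ// normr0 !mul0r expr0n.
have [q qs] := exists_descent_point (sum2 s).
exists (q :: s); split; first by rewrite /= sN.
under eq_fun do rewrite big_cons addrC.
rewrite L2norm_sqrD// -natr1 mulrDl mul1r.
have : L2norm P (Y q) ^+ 2 <= (2 * S) ^+ 2.
  by rewrite ler_pXn2r ?nnegrE ?L2norm_ge0 ?mulr_ge0.
by lra.
Qed.

Lemma centered_normal_path_integral : centered_normal P I.
Proof.
apply: centered_normal_limit => // e e0.
(* The average of N errors has squared norm at most (2S)^2 / N; the successor makes N positive and
   brings this bound below e^2. *)
pose N := (Num.truncn ((2 * S) ^+ 2 / e ^+ 2)).+1.
have [s [sN hs]] := exists_greedy_points N.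
have N0 : 0 < (N%:R : R) by [].
pose YS w := \sum_(q <- s) Y q w.
exists (fun w => \sum_(q <- s) N%:R^-1 * (S / (sigma q + 1)) * H (w, q)); split.
  exact: (centered_normal_lincomb s (fun q => N%:R^-1 * (S / (sigma q + 1)))).
have -> : (fun w => \sum_(q <- s) N%:R^-1 * (S / (sigma q + 1)) * H (w, q) - I w)
   = fun w => N%:R^-1 * YS w.
  apply/funext => w; rewrite /YS /Y sumrB mulrBr mulr_sumr.
  congr (_ - _); first by apply: eq_bigr => q _; rewrite -mulrA.
  rewrite big_const_seq count_predT sN iter_addr_0 -(mulr_natl (I w)) mulKf ?(gt_eqF N0)//.
have sum2 : YS \in Lfun P 2%:E by exact: Lfun2_sum.
rewrite (L2normZ _ sum2) -(@ler_pXn2r _ 2) ?nnegrE ?mulr_ge0 ?L2norm_ge0 ?(ltW e0)//.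
have {}hs : L2norm P YS ^+ 2 <= N%:R * (2 * S) ^+ 2 := hs.
rewrite exprMn ger0_norm ?invr_ge0//.
apply: (@le_trans _ _ (N%:R^-1 ^+ 2 * (N%:R * (2 * S) ^+ 2))).
  by rewrite ler_wpM2l ?exprn_ge0 ?invr_ge0.
have -> : N%:R^-1 ^+ 2 * (N%:R * (2 * S) ^+ 2) = (2 * S) ^+ 2 / N%:R.
  by field; rewrite gt_eqF.
rewrite ler_pdivrMr// [leRHS]mulrC -ler_pdivrMr ?exprn_gt0//.
by rewrite ltW// truncnS_gt.
Qed.

End gaussian_path_integral.

(** * Integration over an interval as a map on L1q *)

(** An integrand on [D] is traded for its extension by 0, so that results for a finite measure on a
    whole space apply to an interval. *)
Lemma integral_mfrestr d (T : measurableType d) (R : realType)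
    (mu : {measure set T -> \bar R}) (D : set T) (mD : measurable D)
    (muD : (mu D < +oo)%E) (f g : T -> \bar R) :
  (forall x, D x -> f x = g x) -> (forall x, ~ D x -> f x = 0%E) ->
  (\int[mfrestr mD muD]_x f x = \int[mu]_(x in D) g x)%E.
Proof.
move=> fg f0; have -> : f = g \_ D.
  apply/funext => x; rewrite patchE; case: ifPn => [/set_mem|xD]; first exact: fg.
  by apply: f0; move/negP : xD => + Dx; apply; exact: mem_set.
rewrite -integral_mkcond; apply: eq_measure_integral => A mA AD.
by transitivity (mu (A `&` D)); [|rewrite setIidl].
Qed.

Lemma Rintegral_mfrestr d (T : measurableType d) (R : realType)
    (mu : {measure set T -> \bar R}) (D : set T) (mD : measurable D)
    (muD : (mu D < +oo)%E) (f g : T -> R) :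
  (forall x, D x -> f x = g x) -> (forall x, ~ D x -> f x = 0) ->
  \int[mfrestr mD muD]_x f x = \int[mu]_(x in D) g x.
Proof.
move=> fg f0; rewrite /Rintegral; congr fine.
by apply: integral_mfrestr => x Dx; congr EFin; [exact: fg|exact: f0].
Qed.

Lemma expectation_distribution d d' (T : measurableType d) (T' : measurableType d')
    (R : realType) (P : probability T R) (X : {RV P >-> T'}) (f : T' -> R) :
  measurable_fun setT f -> ('E_(distribution P X)[f] = 'E_P[f \o X])%E.
Proof.
move=> mf; rewrite unlock.
have mf' : measurable_fun setT (EFin \o f) by exact/measurable_EFinP.
rewrite [LHS]integralE [RHS]integralE -/(EFin \o f).
rewrite (_ : (fun x => ((f \o X) x)%:E) = (EFin \o f) \o X)//.
rewrite (funepos_comp (EFin \o f) X) (funeneg_comp (EFin \o f) X).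
rewrite !ge0_integral_distribution//.
- exact: measurable_funeneg.
- exact: measurable_funepos.
Qed.

Lemma measurable_preimage_open (T U : ptopologicalType) (f : T -> U) :
  continuous f -> measurable_fun setT (f : borel T -> borel U).
Proof.
move=> /continuousP cf; apply: (@measurability _ _ (borel T) (borel U) setT f (@open U)) => //.
move=> _ [A oA <-]; rewrite setTI; apply: sub_sigma_algebra; exact: cf.
Qed.

Lemma measurable_borel_real (T : ptopologicalType) (R : realType) (f : T -> R) :
  continuous f -> measurable_fun setT (f : borel T -> R).
Proof.
move=> /continuousP cf.
apply: (@measurability _ _ (borel T) (measurableTypeR R) setT f
  (@RGenOpens.G R)).
  exact: RGenOpens.measurableE.
move=> _ [_ [x [y ->]] <-]; rewrite setTI; apply: sub_sigma_algebra; apply: cf.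
exact: interval_open.
Qed.

Lemma continuous_mx (T : topologicalType) (R : realType) m n (f : T -> 'M[R]_(m, n)) :
  (forall i j, continuous (fun x => f x i j)) -> continuous f.
Proof.
move=> cf x A [B nB BA]; rewrite /nbhs/=.
have : \forall y \near x, forall ij : 'I_m * 'I_n, B ij.1 ij.2 (f y ij.1 ij.2).
  by apply: filter_forall => -[i j]; apply: cf; exact: nB.
by apply: filterS => y By; apply: BA => i j; exact: (By (i, j)).
Qed.

Section itv_integral.
Context (R : realType) (q : nat) (l u : R).
Hypotheses (l0 : 0 <= l) (u1 : u <= 1).
Local Notation leb := (@lebesgue_measure R).
Implicit Types b c : L1q R q.

(** Seen as an element of [LfunType], the coordinate carries its measurability and its finite
    norm. *)
Definition L1q_coord b (i : 'I_q) : R -> R := (b : {ffun _}) i.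

Lemma L1q_coordE b i p : b p i 0 = L1q_coord b i p.
Proof. by rewrite /L1q_fun mxE. Qed.

Lemma measurable_L1q_coord b i : measurable_fun setT (L1q_coord b i : measurableTypeR R -> R).
Proof. by have /andP[] := LfunP ((b : {ffun _}) i); rewrite inE. Qed.

Let sub01 : (`]l, u[%classic : set R) `<=` `]0, 1[%classic.
Proof.
move=> x /=; rewrite !in_itv/= => /andP[lx xu]; apply/andP; split.
  exact: le_lt_trans lx.
exact: lt_le_trans u1.
Qed.

Lemma le_integral_leb01 b i :
  (\int[leb]_(p in `]l, u[) `|L1q_coord b i p|%:E <=
   'N[@leb01 R]_1[EFin \o L1q_coord b i])%E.
Proof.
have mb := measurable_L1q_coord b i.
have mabs (D : set R) : measurable D ->
    measurable_fun D (fun p : measurableTypeR R => `|L1q_coord b i p|%:E).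
  by move=> mD; apply/measurable_funTS/measurable_EFinP; exact: measurableT_comp.
rewrite Lnorm1.
apply: (@le_trans _ _ (\int[leb]_(p in `]0%R, 1%R[) `|L1q_coord b i p|%:E)%E).
  by apply: ge0_subset_integral => //; exact: mabs.
rewrite (_ : (\int[leb]_(p in _) _)%E =
    (\int[@leb01 R]_(p in `]0%R, 1%R[) `|L1q_coord b i p|%:E)%E).
  by apply: ge0_subset_integral => //; exact: mabs.
apply: eq_measure_integral => A mA A01.
by transitivity (leb (A `&` `]0%R, 1%R[)); [rewrite setIidl|].
Qed.

Lemma L1q_coord_integrable b i :
  leb.-integrable `]l, u[ (fun p => (L1q_coord b i p)%:E).
Proof.
apply/integrableP; split.
  by apply/measurable_funTS/measurable_EFinP; exact: measurable_L1q_coord.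
apply: le_lt_trans (le_integral_leb01 b i) _.
by have /andP[_] := LfunP ((b : {ffun _}) i); rewrite inE.
Qed.

(** The factor [a] is there for sqrt n; a = 1 serves the Lipschitz bound. *)
Lemma itv_integralB (a : R) b c :
  itv_integral (a *: (b - c) : L1q R q) l u =
  a *: (itv_integral b l u - itv_integral c l u).
Proof.
apply/colP => i; rewrite !mxE.
under eq_Rintegral do rewrite L1q_coordE.
under [X in _ = a * (X - _)]eq_Rintegral do rewrite L1q_coordE.
under [X in _ = a * (_ - X)]eq_Rintegral do rewrite L1q_coordE.
rewrite -RintegralB//; [|exact: L1q_coord_integrable|exact: L1q_coord_integrable].
rewrite -RintegralZl//; last first.
  by apply: (integrableB _ (L1q_coord_integrable b i) (L1q_coord_integrable c i)).
by apply: eq_Rintegral => p _; rewrite /L1q_coord !ffunE.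
Qed.

Lemma normr_itv_integral b i : `|itv_integral b l u i 0| <= L1q_norm b.
Proof.
rewrite mxE; under eq_Rintegral do rewrite L1q_coordE.
have fin j : ('N[@leb01 R]_1[EFin \o L1q_coord b j])%E \is a fin_num.
  have /andP[_] := LfunP ((b : {ffun _}) j); rewrite inE => h.
  by rewrite ge0_fin_numE ?Lnorm_ge0.
apply: (@le_trans _ _ (fine ('N[@leb01 R]_1[EFin \o L1q_coord b i])%E)).
  rewrite -lee_fin fineK// EFin_normr_Rintegral//; last exact: L1q_coord_integrable.
  apply: le_trans (le_integral_leb01 b i); apply: le_abse_integral => //.
  by case/integrableP: (L1q_coord_integrable b i).
rewrite /L1q_norm (bigD1 i)//= lerDl sumr_ge0// => j _.
by rewrite fine_ge0// Lnorm_ge0.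
Qed.

Lemma itv_integral_lipschitz b c i :
  `|itv_integral b l u i 0 - itv_integral c l u i 0| <= L1q_norm (b - c).
Proof.
have -> : itv_integral b l u i 0 - itv_integral c l u i 0 =
    itv_integral (1 *: (b - c) : L1q R q) l u i 0.
  by rewrite itv_integralB scale1r !mxE.
by apply: le_trans (normr_itv_integral _ _) _; rewrite scale1r.
Qed.

Lemma continuous_itv_integral :
  continuous (fun b : L1q R q => itv_integral b l u : 'cV[R]_q).
Proof.
apply: continuous_mx => i j b; rewrite (ord1 j).
apply/(@cvg_ballP _ _ _ _ (nbhs_filter b)) => e e0.
have : nbhs b (ball b e) by exact: nbhsx_ballx.
rewrite ball_L1qE; apply: filterS => c; apply: le_lt_trans.
exact: itv_integral_lipschitz.
Qed.

End itv_integral.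

(** * Integrals of the Gaussian process over a subinterval of (0,1) *)

Section gaussian_itv_integral.
Context (R : realType) (q : nat) d (Omega : measurableType d) (P : probability Omega R).
Context (G : Omega -> L1q R q) (Rcov : R -> R -> 'M[R]_q).
Hypothesis HG : centered_gaussian_process P G Rcov.
Context (l u : R).
Hypotheses (l0 : 0 <= l) (lu : l < u) (u1 : u <= 1).
Local Notation leb := (@lebesgue_measure R).

Let D : set (measurableTypeR R) := `]l, u[%classic.

Let mD : measurable D. Proof. exact: measurable_itv. Qed.

Let lebD : leb D = (u - l)%:E.
Proof. by rewrite lebesgue_measure_itv/= lte_fin lu. Qed.

Let lebDy : (leb D < +oo)%E. Proof. by rewrite lebD ltry. Qed.

Let mu : {finite_measure set _ -> \bar R} := mfrestr mD lebDy.

Let D01 p : D p -> p \in `]0, 1[.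
Proof.
rewrite /D/= !in_itv/= => /andP[lp pu]; rewrite (le_lt_trans l0 lp)/=.
exact: lt_le_trans pu u1.
Qed.

Let mu0 : mu setT != 0%E.
Proof.
rewrite (_ : mu setT = leb D); last by rewrite /mu/= /mfrestr/= /mrestr setTI.
by rewrite lebD eqe subr_eq0 gt_eqF.
Qed.

(** Extended by 0, because the values of [G] outside (0,1) are unconstrained, while the results on
    path integrals ask every p to give a square integrable variable. *)
Let proc (i : 'I_q) : Omega * measurableTypeR R -> R :=
  (fun wp => G wp.1 wp.2 i 0) \_ (setT `*` D).

Let procE i w p : proc i (w, p) = if p \in D then G w p i 0 else 0.
Proof. by rewrite /proc patchE in_setX in_setT. Qed.

Let mproc i : measurable_fun setT (proc i).
Proof.
have mTD : measurable ([set: Omega] `*` D) by exact: measurableX.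
apply/(measurable_restrictT _ mTD); have [mG _ _ _] := HG.
apply: measurable_funS (mG i) => //; first exact: measurableX.
by move=> [w p] [_ /= Dp]; split => //; exact: D01.
Qed.

Let comb (a : 'I_q -> R) (wp : Omega * measurableTypeR R) : R :=
  \sum_i a i * proc i wp.

Let mcomb a : measurable_fun setT (comb a).
Proof.
by apply: measurable_sum => i; apply: measurable_funM.
Qed.

Let normal_comb a (N : nat) (p : 'I_N -> measurableTypeR R) (c : 'I_N -> R) :
  is_normal P (fun w => \sum_k c k * comb a (w, p k)).
Proof.
have [_ jn _ _] := HG; pose mid : R := (l + u) / 2.
have Dmid : D mid by rewrite /D/= in_itv/= (midf_lt lu).1 (midf_lt lu).2.
(* Points outside [D] contribute 0; they are moved to the midpoint, where the Gaussian hypothesis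
   applies, and get the coefficient 0. *)
pose p' k : R := if p k \in D then p k else mid.
have p'01 k : p' k \in `]0, 1[.
  by apply: D01; rewrite /p'; case: ifPn => // /set_mem.
have := jn N p' p'01 (fun ki => if p ki.1 \in D then c ki.1 * a ki.2 else 0).
congr is_normal; apply/funext => w; rewrite /comb.
under [RHS]eq_bigr do rewrite mulr_sumr.
rewrite pair_bigA; apply: eq_bigr => -[k i] _ /=; rewrite procE /p'.
by case: ifPn => _; [rewrite mulrA|rewrite mul0r !mulr0].
Qed.

Let mproc_w i p : measurable_fun setT (fun w => proc i (w, p)).
Proof. exact: (measurableT_comp (mproc i)). Qed.

Let proc_L2 i p : (fun w => proc i (w, p)) \in Lfun P 2%:E.
Proof.
apply: moment2_Lfun => //; under eq_fun do rewrite procE.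
have [pD|pD] := boolP (p \in D); last first.
  by rewrite /moment2; under eq_fun do rewrite expr0n/=; rewrite (expectation_cst P 0) ltry.
have [_ _ _ EGG] := HG; rewrite /moment2; under eq_fun do rewrite expr2.
by rewrite EGG ?ltry//; exact/D01/set_mem.
Qed.

Let proc_E i p : 'E_P[fun w => proc i (w, p)]%E = 0%E.
Proof.
under eq_fun do rewrite procE.
have [pD|pD] := boolP (p \in D); last exact: expectation_cst.
have [_ _ EG _] := HG; exact/EG/D01/set_mem.
Qed.

Let comb_L2 a p : (fun w => comb a (w, p)) \in Lfun P 2%:E.
Proof. by rewrite /comb; apply: Lfun2_sum => i; exact: LfunZ2. Qed.

Let comb_E a p : 'E_P[fun w => comb a (w, p)]%E = 0%E.
Proof.
rewrite expectation_sum2; last by move=> i; exact: LfunZ2.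
rewrite big1// => i _.
have -> : (fun w => a i * proc i (w, p)) = a i \o* (fun w => proc i (w, p)).
  by apply/funext => w /=; rewrite mulrC.
by rewrite expectationZl ?proc_E ?mule0//; exact: Lfun2_Lfun1.
Qed.

Let proc_integrable i w : mu.-integrable setT (fun p => (proc i (w, p))%:E).
Proof.
apply/integrableP; split.
  by apply/measurable_EFinP; exact: (measurableT_comp (mproc i)).
rewrite (@integral_mfrestr _ _ _ leb D mD lebDy _ (fun p => `|L1q_coord (G w) i p|%:E)).
- by case/integrableP: (L1q_coord_integrable l0 u1 (G w) i).
- by move=> p Dp; rewrite procE mem_set// L1q_coordE.
- by move=> p Dp; rewrite procE memNset// abse0.
Qed.

Let comb_integrable a w : mu.-integrable setT (fun p => (comb a (w, p))%:E).
Proof.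
rewrite /comb; under eq_fun do rewrite -sumEFin.
apply: integrable_sum => // i _; under eq_fun do rewrite EFinM.
exact: integrableZl.
Qed.

Let path_integral_proc i w : path_integral mu (proc i) w = itv_integral (G w) l u i 0.
Proof.
rewrite /itv_integral mxE; apply: Rintegral_mfrestr => p Dp; rewrite procE.
  by rewrite mem_set.
by rewrite memNset.
Qed.

Let path_integral_comb a w :
  path_integral mu (comb a) w = \sum_i a i * itv_integral (G w) l u i 0.
Proof.
apply: EFin_inj; rewrite -(path_integralE (comb_integrable a)).
rewrite /comb; under eq_integral do rewrite -sumEFin.
rewrite integral_sum//; last first.
  by move=> i; under eq_fun do rewrite EFinM; exact: integrableZl.
rewrite -sumEFin; apply: eq_bigr => i _.
under eq_integral do rewrite EFinM.
by rewrite integralZl// (path_integralE (proc_integrable i)) path_integral_proc.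
Qed.

Lemma centered_normal_itv_integral (a : 'I_q -> R) :
  centered_normal P (fun w => \sum_i a i * itv_integral (G w) l u i 0).
Proof.
rewrite (_ : (fun w => _) = path_integral mu (comb a)); last first.
  by apply/funext => w; rewrite path_integral_comb.
exact: centered_normal_path_integral.
Qed.

(** Makes the integrability of the standard deviation available for a single coordinate. *)
Let comb_delta i : comb (fun j => (j == i)%:R) = proc i.
Proof.
apply/funext => wp; rewrite /comb (bigD1 i)//= eqxx mul1r big1 ?addr0// => j ji.
by rewrite (negbTE ji) mul0r.
Qed.

Let proc_sd i : mu.-integrable setT (EFin \o sd P (proc i)).
Proof.
rewrite -comb_delta; apply: integrable_sd_gaussian => //.
Qed.

(** [L2dot_path_integral] is used once per factor: opening coordinate j first makes s the outer
    variable, then coordinate i gives p, as in [itv_integral2]. *)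
Lemma covariance_itv_integral (i j : 'I_q) :
  ('E_P[fun w => (itv_integral (G w) l u i 0 * itv_integral (G w) l u j 0)%R]
    = (itv_integral2 Rcov l u i j)%:E)%E.
Proof.
have I2 k : path_integral mu (proc k) \in Lfun P 2%:E by exact: path_integral_L2.
under eq_fun do rewrite -!path_integral_proc.
rewrite L2dotE//; congr EFin.
rewrite L2dot_path_integral// mxE.
apply: Rintegral_mfrestr => s Ds; last first.
  rewrite /L2dot; under eq_Rintegral do rewrite procE memNset// mulr0.
  by rewrite /Rintegral integral0.
(* The remaining path integral has to be the second argument to be opened. *)
transitivity (L2dot P (fun w => proc j (w, s)) (path_integral mu (proc i))).
  by apply: eq_Rintegral => w _; rewrite mulrC.
rewrite L2dot_path_integral//.
apply: Rintegral_mfrestr => p Dp; last first.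
  rewrite /L2dot; under eq_Rintegral do rewrite (procE i) memNset// mulr0.
  by rewrite /Rintegral integral0.
apply: EFin_inj; rewrite -L2dotE//.
have [_ _ _ EGG] := HG; rewrite -EGG ?D01//.
by congr expectation; apply/funext => w; rewrite !procE !mem_set// mulrC.
Qed.

End gaussian_itv_integral.

(** * From linear combinations to the law on R^q *)

Section multivariate_normal_law.
Context (R : realType) (q : nat) d (Omega : measurableType d) (P : probability Omega R).
Context (Z : {RV P >-> borel 'cV[R]_q}) (Sigma : 'M[R]_q).
Local Notation coord i := (fun z : 'cV[R]_q => z i 0).

Let mcoord i : measurable_fun setT (coord i : borel 'cV[R]_q -> R).
Proof. by apply: measurable_borel_real => z; exact: coord_continuous. Qed.

Lemma multivariate_normal_distribution :
  (forall a : 'I_q -> R, centered_normal P (fun w => \sum_i a i * (Z w : 'cV[R]_q) i 0)) ->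
  (forall i j, ('E_P[fun w => ((Z w : 'cV[R]_q) i 0 * (Z w : 'cV[R]_q) j 0)%R] =
    (Sigma i j)%:E)%E) ->
  multivariate_normal (distribution P Z) 0 Sigma.
Proof.
move=> Z0 ZS.
have E0 i : ('E_(distribution P Z)[coord i] = 0)%E.
  rewrite expectation_distribution//.
  have [_ + _] := Z0 (fun j => (j == i)%:R).
  congr ('E_P[_] = _)%E; apply/funext => w /=.
  by rewrite (bigD1 i)//= eqxx mul1r big1 ?addr0// => j ji; rewrite (negbTE ji) mul0r.
split.
- move=> a; have [_ _ [_ [c [s cs]]]] := Z0 a; split; last by exists c, s.
  by apply: measurable_sum => i; exact: measurable_funM.
- by move=> i; rewrite E0 mxE.
- move=> i j; rewrite unlock !E0/= -ZS.
  transitivity ('E_(distribution P Z)[fun z : 'cV[R]_q => (z i 0 * z j 0)%R])%E.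
    congr expectation; apply/funext => z.
    by transitivity ((z i 0 - 0) * (z j 0 - 0)); [|rewrite !subr0].
  by rewrite expectation_distribution//; exact: measurable_funM.
Qed.

End multivariate_normal_law.

Theorem proposition3 (R : realType) (m q : nat)
  (d : measure_display) (Omega : measurableType d) (P : probability Omega R)
  (Y : nat -> {RV P >-> R}) (x : nat -> 'cV[R]_m) (t : 'cV[R]_m -> 'cV[R]_q)
  (b : L1q R q)
  (Hmodel : linear_quantile_sample Y x t b)
  (bhat : nat -> {RV P >-> borel (L1q R q)})
  (Hbhat : forall n, computed_from_sample Y x n (bhat n))
  (d' : measure_display) (Omega' : measurableType d')
  (P' : probability Omega' R) (G : {RV P' >-> borel (L1q R q)})
  (Rcov : R -> R -> 'M[R]_q)
  (HG : centered_gaussian_process P' G Rcov)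
  (Hcvg : weak_cvg P
    (fun n w => Num.sqrt (n%:R : R) *: ((bhat n w : L1q R q) - b))
    (distribution P' G))
  (K : nat) (lam : nat -> R)
  (Hlam0 : lam 0%N = 0) (HlamK : lam K = 1)
  (Hlam : forall k, (k < K)%N -> lam k < lam k.+1) :
  forall k, (1 <= k <= K)%N ->
    exists nu : probability (borel 'cV[R]_q) R,
      multivariate_normal nu 0 (itv_integral2 Rcov (lam k.-1) (lam k)) /\
      weak_cvg P
        (fun n w => Num.sqrt (n%:R : R) *:
          (itv_integral (bhat n w : L1q R q) (lam k.-1) (lam k) -
           itv_integral b (lam k.-1) (lam k)))
        nu.
Proof.
move=> k /andP[k1 kK].
have lam_le i j : (i <= j)%N -> (j <= K)%N -> lam i <= lam j.
  move=> ij; rewrite -(subnK ij); elim: (j - i)%N => [//|n IHn] nK.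
  by rewrite (le_trans (IHn (ltnW nK)))// addSn ltW// Hlam.
have l0 : 0 <= lam k.-1 by rewrite -Hlam0 lam_le// (leq_trans (leq_pred _)).
have u1 : lam k <= 1 by rewrite -HlamK lam_le.
have lu : lam k.-1 < lam k by rewrite -[in ltRHS](prednK k1) Hlam// prednK.
set l := lam k.-1 in l0 lu *; set u := lam k in u1 lu *.
pose F (b : L1q R q) : 'cV[R]_q := itv_integral b l u.
have cF : continuous F by exact: continuous_itv_integral.
have mF : measurable_fun setT (F : borel (L1q R q) -> borel 'cV[R]_q).
  exact: measurable_preimage_open.
have mFG : measurable_fun setT (F \o G : Omega' -> borel 'cV[R]_q).
  exact: measurableT_comp.
pose FG : {RV P' >-> borel 'cV[R]_q} :=
  HB.pack (F \o G : Omega' -> borel 'cV[R]_q) (isMeasurableFun.Build _ _ _ _ _ mFG).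
(* By linearity, the sequence is the image under [F] of the one that converges weakly in [L1q]. *)
have FE n w : Num.sqrt n%:R *: (itv_integral (bhat n w : L1q R q) l u - itv_integral b l u) =
    F (Num.sqrt n%:R *: ((bhat n w : L1q R q) - b)).
  by rewrite /F itv_integralB.
exists (distribution P' FG); split.
  apply: multivariate_normal_distribution.
  - exact: (centered_normal_itv_integral HG).
  - exact: (covariance_itv_integral HG).
have [mX cvgX] := Hcvg; split.
  by move=> n; under eq_fun do rewrite FE; exact: (measurableT_comp mF (mX n)).
(* Composing with [F] turns a bounded continuous test function on R^q into one on [L1q]. *)
move=> f cf bf; have cfF : continuous (f \o F).
  by move=> z; apply: continuous_comp; [exact: cF|exact: cf].
have [M fM] := bf; have := cvgX (f \o F) cfF (ex_intro _ M (fun z => fM (F z))).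
rewrite expectation_distribution; last exact: measurable_borel_real.
rewrite expectation_distribution; last exact: measurable_borel_real.
move=> cvgfF; rewrite (_ : (fun n => _) = fun n =>
    'E_P[fun w => f (F (Num.sqrt n%:R *: ((bhat n w : L1q R q) - b)))]%E)//.
by apply/funext => n; congr expectation; apply/funext => w; rewrite FE.
Qed.
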